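(* Let $F$ be a countable principal ideal domain with identity with a fixed infinite set $S$ of pairwise coprime elements, let $\lambda$ be a regular cardinal with $\aleph_1\le\lambda\le2^{\aleph_0}$, and let $R=\bigcup_{\alpha<\lambda}R_\alpha$ be the $F$-algebra constructed in the context. Then $R$ is a domain, $|R|=\lambda$, and $R$ is an $\aleph_1$-free $F$-module. Moreover, for every ordinal $\alpha<\lambda$, the quotient $R/R_\alpha$ is an $\aleph_1$-free $F$-module.
   Context: Setting. $F$ is a countable principal ideal domain with identity, with a fixed infinite set $S=\{s_n:n\in\omega\}$ of pairwise coprime elements ($s_nF+s_mF=F$ for $n\neq m$). Put $q_0=1$ and $q_{n+1}=s_nq_n$. For an $F$-module $M$, the $S$-topology is the linear topology with neighbourhood basis of $0$ given by the submodules $q_nM$ ($n\in\omega$). $\lambda$ is a regular cardinal with $\aleph_1\le\lambda\le 2^{\aleph_0}$. An $F$-module is $\aleph_1$-free if every countably generated submodule is free. Trees. $T=\{\tau:n\to 2 \mid n\in\omega\}$ (finite branches), with length $l(\tau)=n$ for $\tau:n\to2$; $\mathrm{Br}(T)$ is the set of all $\eta:\omega\to 2$, and $\eta\restriction_n$ denotes restriction to $n$. For $C\subseteq\omega$ let $T_C=\{\tau\in T:\tau(e)=0 \text{ for all } e\in l(\tau)\setminus C\}$ and $\mathrm{Br}(T_C)=\{\eta\in\mathrm{Br}(T):\eta(e)=0\text{ for all }e\in\omega\setminus C\}$. Fix a family $\{C_\alpha:\alpha<\lambda\}$ of infinite, pairwise almost disjoint subsets of $\omega$, let $T_\alpha=T_{C_\alpha}\times\{\alpha\}$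 (pairwise disjoint copies) and $T_\Lambda=\bigcup_{\alpha<\lambda}T_\alpha$. For $\eta\in\mathrm{Br}(T_{C_\alpha})$, $z_{\eta\restriction_i}$ denotes the variable indexed by $(\eta\restriction_i,\alpha)\in T_\alpha$. Base algebra. $B_\Lambda=F[z_\tau:\tau\in T_\Lambda]$ is the polynomial ring in commuting indeterminates $z_\tau$, a free $F$-module on its monomials; $\widehat{B_\Lambda}$ is its completion in the $S$-topology. For each $\alpha<\lambda$ fix $V_\alpha\subseteq\mathrm{Br}(T_{C_\alpha})$ with $|V_\alpha|=\lambda$ such that for every $m\in\omega$ there are $\lambda$ many pairs of distinct branches in $V_\alpha$ whose first point of difference is above $m$. Branch-like elements. For $\alpha<\lambda$, $\eta\in V_\alpha$, $n\in\omega$ and $x\in\widehat{B_\Lambda}$ put $y_{\eta n x}=\sum_{i\ge n}\frac{q_i}{q_n}z_{\eta\restriction_i}+x\sum_{i\ge n}\frac{q_i}{q_n}\eta(i)\in\widehat{B_\Lambda}$. Norm. For $b\in B_\Lambda$, $\|b\|$ is the least ordinal $\beta<\lambda$ such that every variable $z_\tau$ occurring in $b$ has $\tau\in\bigcup_{\gamma<\beta}T_\gamma$. Construction. Fix a sequence $(b_\alpha:\alpha<\lambda)$ which runs $\lambda$ times through all nonzero elements of $B_\Lambda$ of the form $\sum_{m\in M}m$ with $M$ a finite set of monomials. Define $F$-subalgebras of $\widehat{B_\Lambda}$: $R_0=\{0\}$, $R_1=F$, $R_\alpha=\bigcup_{\beta<\alpha}R_\beta$ for limit $\alpha$, and $R_{\alpha+1}=R_\alpha[y_{\eta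 n x_\alpha},z_\tau:\eta\in V_\alpha,\tau\in T_\alpha,n\in\omega]$, where $x_\alpha=b_\alpha$ if $b_\alpha\in R_\alpha$ and $\|b_\alpha\|\le\alpha$, and $x_\alpha=0$ otherwise. Finally $R=R_\lambda=\bigcup_{\alpha<\lambda}R_\alpha$.
   Formalization: For n ≥ 1 the series defining y_{ηnx} diverge in the S-topology; they are replaced by any tails w_n with w_n = u_n + s_n w_{n+1} (such tails exist), w_0 being the S-adic sum. The s_n are assumed nonzero and the S-topology on F Hausdorff. *)

(* Defs.v *)
From HB Require Import structures.
From mathcomp Require Import all_boot all_order all_algebra.
From mathcomp Require Import generic_quotient ring_quotient.
From mathcomp Require Import finmap monalg ring.
From mathcomp Require Import boolp classical_sets functions cardinality.

Set Implicit Arguments.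
Unset Strict Implicit.
Unset Printing Implicit Defensive.

Import Order.TTheory GRing.Theory.
Local Open Scope classical_set_scope.
Local Open Scope card_scope.
Local Open Scope ring_scope.

Section Modules.
Variables (F : comNzRingType) (M : lmodType F).
Implicit Types (A X N : set M).

Definition submodule N := submod_closed [in N].

Definition lspan A : set M := smallest submodule A.

Definition lin_indep X :=
  forall (r : seq M) (c : M -> F), uniq r -> (forall x, x \in r -> X x) ->
    \sum_(x <- r) c x *: x = 0 -> forall x, x \in r -> c x = 0.

Definition free_module N := exists2 X, lin_indep X & lspan X = N.

(* N is meant to be a submodule of M. *)
Definition aleph1_free N :=
  forall A, A `<=` N -> countable A -> free_module (lspan A).

Lemma lspan_submod A : submodule (lspan A).
Proof.
split; first by rewrite inE => N [[N0 _] _]; move: N0; rewrite inE.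
move=> a u v; rewrite !inE => Au Av N NA; have [[_ Nl] _] := NA.
move: (Nl a u v); rewrite !inE; apply; [exact: Au|exact: Av].
Qed.

Lemma lspan_id N : submodule N -> lspan N = N.
Proof. exact: smallest_id. Qed.

Definition lspan_pred A : {pred M} := [in lspan A].

Lemma lspan_zmod A : zmod_closed (lspan_pred A).
Proof. exact: GRing.submod_closedB (lspan_submod A). Qed.

HB.instance Definition _ A :=
  GRing.isZmodClosed.Build M (lspan_pred A) (lspan_zmod A).

(* The quotient M / N, as an F-module. The relation is congruence modulo the
   submodule generated by N, so that the type makes sense for every set N. *)
Definition quot_mod N := Quotient.quot (lspan_pred N).

HB.instance Definition _ N := GRing.Zmodule.on (quot_mod N).

Local Open Scope quotient_scope.

Definition quot_map N (x : M) : quot_mod N := \pi_(quot_mod N) x.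

Lemma quot_mapP N x y : quot_map N x = quot_map N y <-> lspan N (x - y).
Proof.
rewrite /quot_map; split.
  by move/eqP; rewrite -Quotient.idealrBE /lspan_pred inE.
by move=> h; apply/eqP; rewrite -Quotient.idealrBE /lspan_pred inE.
Qed.

Definition quot_scale N (a : F) (x : quot_mod N) : quot_mod N :=
  quot_map N (a *: repr x).

Lemma quot_mapZ N a x : quot_map N (a *: x) = quot_scale a (quot_map N x).
Proof.
apply/quot_mapP; rewrite -scalerBr; set y := repr _.
have : lspan N (x - y) by apply/quot_mapP; rewrite /quot_map reprK.
have [_ /(_ a (x - y) 0)] := lspan_submod N.
by rewrite !inE addr0 => h /h; apply; move=> K [[]]; rewrite inE.
Qed.

Lemma quot_mapD N : {morph @quot_map N : x y / x + y}.
Proof. by move=> x y; rewrite /quot_map; apply: (raddfD (\pi_(quot_mod N))). Qed.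

Lemma quot_map_surj N (x : quot_mod N) : exists y, x = quot_map N y.
Proof. by exists (repr x); rewrite /quot_map reprK. Qed.

Lemma quot_scaleA N a b (x : quot_mod N) :
  quot_scale a (quot_scale b x) = quot_scale (a * b) x.
Proof. by have [y ->] := quot_map_surj x; rewrite -!quot_mapZ scalerA. Qed.
Lemma quot_scale1 N : left_id 1 (@quot_scale N).
Proof. by move=> x; have [y ->] := quot_map_surj x; rewrite -!quot_mapZ scale1r. Qed.
Lemma quot_scaleDr N : right_distributive (@quot_scale N) +%R.
Proof.
move=> a x y; have [u ->] := quot_map_surj x; have [v ->] := quot_map_surj y.
by rewrite -quot_mapD -!quot_mapZ -quot_mapD scalerDr.
Qed.
Lemma quot_scaleDl N (x : quot_mod N) :
  {morph (@quot_scale N)^~ x : a b / a + b}.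
Proof.
by move=> a b; have [y ->] := quot_map_surj x; rewrite -!quot_mapZ scalerDl quot_mapD.
Qed.

HB.instance Definition _ N := GRing.Zmodule_isLmodule.Build F (quot_mod N)
  (@quot_scaleA N) (@quot_scale1 N) (@quot_scaleDr N) (@quot_scaleDl N).

End Modules.

Section Sequence.
Variables (F : idomainType) (s : nat -> F).

Definition ideal (I : set F) :=
  I 0 /\ forall a x y, I x -> I y -> I (a * x + y).

Definition principal_ideal_domain :=
  forall I, ideal I -> exists a, I = range (fun r => a * r).

Definition pairwise_coprime :=
  forall n m, n != m -> exists a b, a * s n + b * s m = 1.

Fixpoint q (n : nat) : F := if n is m.+1 then s m * q m else 1.

Definition S_hausdorff :=
  forall a, (forall n, exists c, a = q n * c) -> a = 0.

(* The element q_i / q_n, for n <= i. *)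
Definition qquot (n i : nat) : F := \prod_(n <= j < i) s j.

Lemma qquotP n i : (n <= i)%N -> qquot n i * q n = q i.
Proof.
elim: i => [|i IH]; first by rewrite leqn0 => /eqP ->; rewrite /qquot big_geq ?mul1r.
rewrite leq_eqVlt => /predU1P[<-|]; first by rewrite /qquot big_geq ?mul1r.
rewrite ltnS => ni; rewrite /qquot big_nat_recr //= mulrAC.
by rewrite -/(qquot n i) IH // mulrC.
Qed.

End Sequence.

(* The completion of M in the S-topology, as the inverse limit of the M/q_n M:
   a class modulo q_n M is encoded by a chosen representative. *)
Section Completion.
Variables (F : idomainType) (s : nat -> F) (M : lmodType F).
Implicit Types (n : nat) (x y z : M).

Definition scong n x y := exists z, x - y = q s n *: z.

Definition srepr n x : M := xget 0 [set y | scong n y x].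

Lemma scong_refl n x : scong n x x.
Proof. by exists 0; rewrite subrr scaler0. Qed.
Lemma scong_sym n x y : scong n x y -> scong n y x.
Proof. by case=> z h; exists (- z); rewrite scalerN -h opprB. Qed.
Lemma scong_trans n y x z : scong n x y -> scong n y z -> scong n x z.
Proof.
by case=> a h [b k]; exists (a + b); rewrite scalerDr -h -k addrA subrK.
Qed.
Lemma scongD n x y x' y' :
  scong n x y -> scong n x' y' -> scong n (x + x') (y + y').
Proof.
by case=> a h [b k]; exists (a + b); rewrite scalerDr -h -k opprD addrACA.
Qed.
Lemma scongN n x y : scong n x y -> scong n (- x) (- y).
Proof. by case=> a h; exists (- a); rewrite scalerN -h opprD. Qed.
Lemma scongZ n c x y : scong n x y -> scong n (c *: x) (c *: y).
Proof.
by case=> a h; exists (c *: a); rewrite -scalerBr h !scalerA mulrC.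
Qed.
Lemma scongS n x y : scong n.+1 x y -> scong n x y.
Proof. by case=> a h; exists (s n *: a); rewrite h scalerA mulrC. Qed.

Lemma sreprK n x : scong n (srepr n x) x.
Proof.
by rewrite /srepr; case: xgetP => [y -> //|/(_ x)]; case; apply: scong_refl.
Qed.
Lemma srepr_eq n x y : scong n x y -> srepr n x = srepr n y.
Proof.
move=> xy; rewrite /srepr; congr xget; apply/seteqP; split=> z /= h.
  exact: scong_trans h xy.
exact: scong_trans h (scong_sym xy).
Qed.

Definition coherent (f : nat -> M) := forall n, scong n (f n.+1) (f n).

Record completion := Completion {
  thread :> nat -> M;
  thread_repr : forall n, srepr n (thread n) = thread n;
  thread_coherent : coherent thread
}.

Lemma completion_ext (u v : completion) :
  (forall n, scong n (u n) (v n)) -> u = v.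
Proof.
case: u v => [f fr fc] [g gr gc] /= h.
have fg : f = g by apply/funext => n; rewrite -fr -gr; apply: srepr_eq.
by case: g / fg gr gc {h} => gr gc; congr Completion; apply: Prop_irrelevance.
Qed.

HB.instance Definition _ := gen_eqMixin completion.
HB.instance Definition _ := gen_choiceMixin completion.

Lemma srepr_idem f n : srepr n (srepr n (f n)) = srepr n (f n) :> M.
Proof. exact/srepr_eq/sreprK. Qed.
Lemma srepr_coherent f : coherent f -> coherent (fun n => srepr n (f n)).
Proof.
move=> fc n; apply: scong_trans (scongS (sreprK _ _)) _.
exact: scong_trans (fc n) (scong_sym (sreprK _ _)).
Qed.

Definition to_completion f (fc : coherent f) : completion :=
  Completion (srepr_idem f) (srepr_coherent fc).

Lemma to_completionE f (fc : coherent f) n : scong n (to_completion fc n) (f n).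
Proof. exact: sreprK. Qed.

Lemma emb_subproof x : coherent (fun=> x).
Proof. by move=> n; apply: scong_refl. Qed.
(* The keys keep unification from unfolding the operations. *)
Fact emb_key : unit. Proof. by []. Qed.
Definition emb x : completion := locked_with emb_key (to_completion (emb_subproof x)).

Lemma cadd_subproof (u v : completion) : coherent (fun n => u n + v n).
Proof. by move=> n; apply: scongD; apply: thread_coherent. Qed.
Fact cadd_key : unit. Proof. by []. Qed.
Definition cadd u v := locked_with cadd_key (to_completion (cadd_subproof u v)).

Lemma copp_subproof (u : completion) : coherent (fun n => - u n).
Proof. by move=> n; apply: scongN; apply: thread_coherent. Qed.
Fact copp_key : unit. Proof. by []. Qed.
Definition copp u := locked_with copp_key (to_completion (copp_subproof u)).

Lemma cscale_subproof a (u : completion) : coherent (fun n => a *: u n).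
Proof. by move=> n; apply: scongZ; apply: thread_coherent. Qed.
Fact cscale_key : unit. Proof. by []. Qed.
Definition cscale a u := locked_with cscale_key (to_completion (cscale_subproof a u)).

Lemma caddE u v n : scong n (cadd u v n) (u n + v n).
Proof. rewrite /cadd unlock; exact: to_completionE. Qed.
Lemma coppE u n : scong n (copp u n) (- u n).
Proof. rewrite /copp unlock; exact: to_completionE. Qed.
Lemma cscaleE a u n : scong n (cscale a u n) (a *: u n).
Proof. rewrite /cscale unlock; exact: to_completionE. Qed.
Lemma embE x n : scong n (emb x n) x.
Proof. rewrite /emb unlock; exact: to_completionE. Qed.

Lemma caddA : associative cadd.
Proof.
move=> u v w; apply: completion_ext => n; apply: scong_trans (caddE _ _ _) _.
apply: scong_trans (scongD (scong_refl _ _) (caddE _ _ _)) _; rewrite addrA.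
apply: scong_sym; apply: scong_trans (caddE _ _ _) _.
exact: scongD (caddE _ _ _) (scong_refl _ _).
Qed.
Lemma caddC : commutative cadd.
Proof.
move=> u v; apply: completion_ext => n; apply: scong_trans (caddE _ _ _) _.
by rewrite addrC; apply: scong_sym; apply: caddE.
Qed.
Lemma cadd0 : left_id (emb 0) cadd.
Proof.
move=> u; apply: completion_ext => n; apply: scong_trans (caddE _ _ _) _.
by rewrite -[X in scong n _ X]add0r; apply: scongD (embE _ _) (scong_refl _ _).
Qed.
Lemma caddN : left_inverse (emb 0) copp cadd.
Proof.
move=> u; apply: completion_ext => n; apply: scong_trans (caddE _ _ _) _.
apply: scong_trans (scongD (coppE _ _) (scong_refl _ _)) _; rewrite addNr.
exact: scong_sym (embE _ _).
Qed.

HB.instance Definition _ :=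
  GRing.isZmodule.Build completion caddA caddC cadd0 caddN.

Lemma cscaleA a b u : cscale a (cscale b u) = cscale (a * b) u.
Proof.
apply: completion_ext => n; apply: scong_trans (cscaleE _ _ _) _.
apply: scong_trans (scongZ _ (cscaleE _ _ _)) _; rewrite scalerA.
exact: scong_sym (cscaleE _ _ _).
Qed.
Lemma cscale1 : left_id 1 cscale.
Proof.
move=> u; apply: completion_ext => n; apply: scong_trans (cscaleE _ _ _) _.
by rewrite scale1r; apply: scong_refl.
Qed.
Lemma cscaleDr : right_distributive cscale +%R.
Proof.
move=> a u v; apply: completion_ext => n; apply: scong_trans (cscaleE _ _ _) _.
apply: scong_trans (scongZ _ (caddE _ _ _)) _; rewrite scalerDr.
apply: scong_sym; apply: scong_trans (caddE _ _ _) _.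
exact: scongD (cscaleE _ _ _) (cscaleE _ _ _).
Qed.
Lemma cscaleDl u : {morph cscale^~ u : a b / a + b}.
Proof.
move=> a b; apply: completion_ext => n; apply: scong_trans (cscaleE _ _ _) _.
rewrite scalerDl; apply: scong_sym; apply: scong_trans (caddE _ _ _) _.
exact: scongD (cscaleE _ _ _) (cscaleE _ _ _).
Qed.

HB.instance Definition _ := GRing.Zmodule_isLmodule.Build F completion
  cscaleA cscale1 cscaleDr cscaleDl.

End Completion.

Section CompletionRing.
Variables (F : idomainType) (s : nat -> F) (A : comAlgType F).
Local Notation cA := (completion s A).

Lemma scongM n (x y x' y' : A) :
  scong s n x y -> scong s n x' y' -> scong s n (x * x') (y * y').
Proof.
case=> a h [b k]; exists (a * x' + y * b).
by rewrite scalerDr scalerAl scalerAr -h -k mulrBl mulrBr addrA subrK.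
Qed.

Lemma cmul_subproof (u v : cA) : coherent s (fun n => u n * v n).
Proof. by move=> n; apply: scongM; apply: thread_coherent. Qed.
Fact cmul_key : unit. Proof. by []. Qed.
Definition cmul u v : cA := locked_with cmul_key (to_completion (cmul_subproof u v)).

Lemma cmulE u v n : scong s n (cmul u v n) (u n * v n).
Proof. rewrite /cmul unlock; exact: to_completionE. Qed.

Lemma cmulA : associative cmul.
Proof.
move=> u v w; apply: completion_ext => n; apply: scong_trans (cmulE _ _ _) _.
apply: scong_trans (scongM (scong_refl _ _ _) (cmulE _ _ _)) _; rewrite mulrA.
apply: scong_sym; apply: scong_trans (cmulE _ _ _) _.
exact: scongM (cmulE _ _ _) (scong_refl _ _ _).
Qed.
Lemma cmulC : commutative cmul.
Proof.
move=> u v; apply: completion_ext => n; apply: scong_trans (cmulE _ _ _) _.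
by rewrite mulrC; apply: scong_sym; apply: cmulE.
Qed.
Lemma cmul1 : left_id (emb s 1) cmul.
Proof.
move=> u; apply: completion_ext => n; apply: scong_trans (cmulE _ _ _) _.
by rewrite -[X in scong s n _ X]mul1r; apply: scongM (embE _ _ _) (scong_refl _ _ _).
Qed.
Lemma cmulDl : left_distributive cmul +%R.
Proof.
move=> u v w; apply: completion_ext => n; apply: scong_trans (cmulE _ _ _) _.
apply: scong_trans (scongM (caddE _ _ _) (scong_refl _ _ _)) _; rewrite mulrDl.
apply: scong_sym; apply: scong_trans (caddE _ _ _) _.
exact: scongD (cmulE _ _ _) (cmulE _ _ _).
Qed.

HB.instance Definition _ :=
  GRing.Zmodule_isComPzRing.Build (completion s A) cmulA cmulC cmul1 cmulDl.

Lemma cscaleAl a (u v : cA) : a *: (u * v) = a *: u * v.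
Proof.
apply: completion_ext => n; apply: scong_trans (cscaleE _ _ _) _.
apply: scong_trans (scongZ _ (cmulE _ _ _)) _; rewrite scalerAl.
apply: scong_sym; apply: scong_trans (cmulE _ _ _) _.
exact: scongM (cscaleE _ _ _) (scong_refl _ _ _).
Qed.

Definition subalgebra (R : set cA) :=
  submod_closed [in R] /\ mulr_closed [in R].

Definition alg_span (X : set cA) : set cA := smallest subalgebra X.

Definition is_domain (R : set cA) :=
  [/\ subring_closed [in R], (1 : cA) != 0 &
      forall x y, R x -> R y -> x * y = 0 -> x = 0 \/ y = 0].

(* [tail_series u w] reads: for every n, w n = \sum_(i >= n) (q_i/q_n) u_i.
   For n = 0 it says that w 0 is the sum of the series of the q_i u_i in the
   S-topology. For n > 0 the partial sums of the series of the (q_i/q_n) u_i are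
   in general not Cauchy in the S-topology, because q_i/q_n is coprime to q_n:
   they converge only for the topology of the submodules (q_m/q_n) M, which is
   not Hausdorff on the completion. The value w n is such a limit, subject to
   the relations that hold between the tails of a convergent series. *)
Definition tail_series (u w : nat -> cA) :=
  forall n m, (n <= m)%N ->
    w n = \sum_(n <= i < m) qquot s n i *: u i + qquot s n m *: w m.

Lemma tail_seriesP u w :
  tail_series u w <-> forall n, w n = u n + s n *: w n.+1.
Proof.
split=> [h n|h n].
  by rewrite (h n n.+1) // big_nat1 /qquot big_geq // big_nat1 scale1r.
elim=> [|m IH]; first by rewrite leqn0 => /eqP ->; rewrite big_geq // add0r
  /qquot big_geq // scale1r.
rewrite leq_eqVlt => /predU1P[<-|].
  by rewrite big_geq // add0r /qquot big_geq // scale1r.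
rewrite ltnS => nm; rewrite {1}IH // big_nat_recr //= -addrA; congr (_ + _).
by rewrite {1}h scalerDr scalerA /qquot big_nat_recr.
Qed.

Lemma coprime_q m n : pairwise_coprime s -> (m <= n)%N ->
  exists a b, a * s n + b * q s m = 1.
Proof.
move=> cop; elim: m => [|m IH] mn; first by exists 0, 1; rewrite mul0r add0r mul1r.
have [a [b ab]] := IH (ltnW mn).
have [|a' [b' ab']] := cop n m; first by rewrite gtn_eqF.
exists (a * (a' * s n + b' * s m) + b * q s m * a'), (b * b').
by rewrite -[RHS]mulr1 -[X in _ = X * _]ab -[X in _ = _ * X]ab' /=; ring.
Qed.

Let level (u : nat -> cA) m (f : nat -> A) :=
  forall n, scong s m (f n) (u n m + s n *: f n.+1).

Lemma tail_series_step u m f : pairwise_coprime s -> level u m f ->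
  exists g, level u m.+1 g /\ forall n, scong s m (g n) (f n).
Proof.
move=> cop lf.
have /choice[a aP] : forall n, exists an,
    (m < n)%N -> exists b, an * s n + b * q s m.+1 = 1.
  move=> n; case: (ltnP m n) => mn; last by exists 0.
  by have [c h] := coprime_q cop mn; exists c.
have ucoh n : scong s m (u n m.+1) (u n m) by apply: thread_coherent.
pose bwd := fix bwd j : A :=
  if j is j'.+1 then u (m - j')%N m.+1 + s (m - j')%N *: bwd j' else f m.+1.
pose fwd := fix fwd j : A :=
  if j is j'.+1 then a (m.+1 + j')%N *: (fwd j' - u (m.+1 + j')%N m.+1)
  else f m.+1.
pose g n := if (n <= m)%N then bwd (m.+1 - n)%N else fwd (n - m.+1)%N.
have gm : g m.+1 = f m.+1 by rewrite /g ltnn subnn.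
have gb n : (n <= m)%N -> g n = u n m.+1 + s n *: g n.+1.
  move=> nm; rewrite {1}/g nm subSn //= subKn //; congr (_ + _ *: _).
  rewrite /g; case: ltnP => h; first by rewrite subSS.
  have -> : n = m by apply/eqP; rewrite eqn_leq nm h.
  by rewrite !subnn.
have gf n : (m < n)%N -> g n.+1 = a n *: (g n - u n m.+1).
  move=> mn; rewrite /g (leqNgt n.+1) ltnS (ltnW mn) (leqNgt n m) mn /=.
  by rewrite subSn //= subnKC.
exists g; split=> [n|].
  case: (leqP n m) => nm; first by rewrite -gb //; apply: scong_refl.
  have [b ab] := aP n nm; rewrite gf //; exists (b *: (g n - u n m.+1)).
  rewrite !scalerA opprD addrA -[X in X - _]scale1r -scalerBl.
  by congr (_ *: _); rewrite -[X in X - _]ab; ring.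
have up n : (m < n)%N -> scong s m (g n) (f n).
  elim: n => // n IH; rewrite ltnS leq_eqVlt => /predU1P[<-|mn].
    by rewrite gm; apply: scong_refl.
  have [b ab] := aP n mn; rewrite gf //.
  apply: (@scong_trans _ _ _ _ (a n *: (f n - u n m))).
    by apply/scongZ/scongD; [exact: IH|apply: scongN].
  apply: (@scong_trans _ _ _ _ (a n *: (s n *: f n.+1))).
    apply: scongZ; have := scongD (lf n) (scong_refl s m (- u n m)).
    by rewrite addrAC subrr add0r.
  exists (- (b * s m) *: f n.+1); rewrite !scalerA.
  rewrite -[X in _ - X]scale1r -scalerBl; congr (_ *: _).
  by rewrite -[X in _ - X]ab /=; ring.
move=> n; case: (leqP n m) => nm; last exact: up.
have down j : (j <= m.+1)%N -> scong s m (g (m.+1 - j)%N) (f (m.+1 - j)%N).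
  elim: j => [_|j IH jm]; first by rewrite subn0; apply: up.
  rewrite subSS gb ?leq_subr // -subSn //.
  apply: scong_trans _ (scong_sym (lf _)).
  by apply: scongD => //; apply: scongZ; rewrite -subSn //; apply/IH/ltnW.
by rewrite -(subKn (leqW nm)); apply: down; rewrite leq_subr.
Qed.

(* Such a family w is unique up to S-torsion: q_n kills the ambiguity of w n. *)
Lemma tail_series_exists u : pairwise_coprime s -> exists w, tail_series u w.
Proof.
move=> cop.
have l0 : level u 0 (fun=> 0).
  by move=> n; exists (- u n 0%N); rewrite scale1r scaler0 addr0 sub0r.
pose W := fix W m : {f | level u m f} :=
  if m is m'.+1 then
    let: exist f lf := W m' in
    let: exist g gP := cid (tail_series_step cop lf) in exist _ g (proj1 gP)
  else exist _ _ l0.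
have Wcoh n : coherent s (fun m => sval (W m) n).
  by move=> m /=; case: (W m) => f lf; case: cid => g [].
exists (fun n => to_completion (Wcoh n)); apply/tail_seriesP => n.
apply: completion_ext => m; apply: scong_trans (to_completionE _ _) _.
apply: scong_trans (svalP (W m) n) _; apply: scong_sym.
apply: scong_trans (caddE _ _ _) _; apply: scongD; first exact: scong_refl.
apply: scong_trans (cscaleE _ _ _) _; apply: scongZ; exact: to_completionE.
Qed.

End CompletionRing.

Section Ordinals.
Variables (d : Order.disp_t) (L : orderType d).
Implicit Types (a b : L).

(* For a well-founded total order L: the order type of L is a regular cardinal
   (an infinite initial ordinal in which every subset of smaller cardinality is
   bounded). The elements of L are then the ordinals below that cardinal. *)
Definition regular_cardinal :=
  [/\ infinite_set [set: L],
      forall a, ~ ([set: L] #<= [set b | (b < a)%O])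
    & forall A : set L, ~ ([set: L] #<= A) -> exists a, forall b, A b -> (b < a)%O].

Definition ozero a := forall b, (a <= b)%O.
Definition osucc b a := (b < a)%O /\ forall c, (b < c)%O -> (a <= c)%O.
Definition olimit a := ~ ozero a /\ forall b, ~ osucc b a.
Definition oleast (P : set L) a := P a /\ forall b, P b -> (a <= b)%O.
End Ordinals.

Section Trees.

(* [tree C] is T_C; the length of a finite branch is its size. *)
Definition tree (C : set nat) : set (seq bool) :=
  [set t | forall e, (e < size t)%N -> ~ C e -> nth false t e = false].

Definition branch (C : set nat) : set (nat -> bool) :=
  [set eta | forall e, ~ C e -> eta e = false].

Lemma restr_subproof C (eta : branch C) n : mkseq (val eta) n \in tree C.
Proof.
rewrite inE => e; rewrite size_mkseq => en Ce; rewrite nth_mkseq //.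
by have := valP eta; rewrite inE; apply.
Qed.
Definition restr C (eta : branch C) n : tree C :=
  exist (fun t => t \in tree C) _ (restr_subproof eta n).

Definition differ_above (m : nat) (eta nu : nat -> bool) :=
  exists n, [/\ (m < n)%N, forall i, (i < n)%N -> eta i = nu i & eta n != nu n].

Variables (d : Order.disp_t) (L : orderType d) (C : L -> set nat).

Definition almost_disjoint :=
  forall a b, a != b -> finite_set (C a `&` C b).

(* T_Lambda, the disjoint union of the T_(C a). *)
Definition var : choiceType := {a : L & tree (C a)}.

Definition many_pairs a (V : set (branch (C a))) :=
  forall m, [set p : branch (C a) * branch (C a) |
      [/\ V p.1, V p.2 & differ_above m (val p.1) (val p.2)]] #= [set: L].
End Trees.

Section Construction.
Variables (F : idomainType) (s : nat -> F).
Variables (d : Order.disp_t) (L : orderType d) (C : L -> set nat).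

Definition base_alg := {malg F[{cmonom (var C)}]}.
HB.instance Definition _ := GRing.ComAlgebra.on base_alg.

Definition bhat := completion s base_alg.
HB.instance Definition _ := GRing.ComPzRing.on bhat.
HB.instance Definition _ := GRing.Lmodule.on bhat.

Definition zvar (t : var C) : base_alg := << ucm t >>.

(* The nonzero sums of finite sets of monomials. *)
Definition monomial_sum (b : base_alg) :=
  b != 0 /\ exists M : {fset {cmonom (var C)}}, b = \sum_(m <- M) << m >>.

Definition occurs (t : var C) (b : base_alg) :=
  exists2 m : {cmonom (var C)}, m \in msupp b & m t != 0%N.

Definition is_norm (b : base_alg) : set L :=
  oleast [set c | forall t, occurs t b -> (tag t < c)%O].

(* [ds u n] stands for \sum_(i >= n) (q_i/q_n) u_i; see [tail_series]. *)
Variable ds : (nat -> bhat) -> nat -> bhat.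

Definition ybranch a (eta : branch (C a)) (n : nat) (x : bhat) : bhat :=
  ds (fun i => emb s (zvar (Tagged (fun a => tree (C a)) (restr eta i)))) n
  + x * ds (fun i => (val eta i)%:R) n.

Variables (V : forall a : L, set (branch (C a))) (b : L -> base_alg).

Definition xsel a (R : set bhat) : bhat :=
  if `[< R (emb s (b a)) /\ exists2 c, is_norm (b a) c & (c <= a)%O >]
  then emb s (b a) else 0.

Definition adjoin a (R : set bhat) : set bhat :=
  alg_span (R `|` [set y | exists (eta : branch (C a)) n,
                      V eta /\ y = ybranch eta n (xsel a R)]
              `|` [set z | exists t : var C, tag t = a /\ z = emb s (zvar t)]).

Definition stage (a : L) (rec : forall c : L, (c < a)%O -> set bhat) : set bhat :=
  [set x : bhat | [\/ ozero a /\ x = 0,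
     exists c, [/\ ozero c, osucc c a & range (fun r : F => r *: (1 : bhat)) x],
     exists c (ca : (c < a)%O),
       [/\ ~ ozero c, osucc c a & adjoin c (rec c ca) x]
   | olimit a /\ exists c (ca : (c < a)%O), rec c ca x]].

Variable wf : well_founded (fun c a : L => (c < a)%O).

Definition Ralpha : L -> set bhat := Fix wf (fun=> set bhat) stage.

Definition Rtop : set bhat := \bigcup_a Ralpha a.

Lemma RalphaE (a : L) : Ralpha a = stage (fun c (_ : (c < a)%O) => Ralpha c).
Proof.
rewrite /Ralpha Fix_eq // => {}a f g fg; congr stage.
by apply: functional_extensionality_dep => c; apply/funext => ca; apply: fg.
Qed.

Lemma osucc_inj (c c' a : L) : osucc c a -> osucc c' a -> c = c'.
Proof.
move=> [ca cl] [ca' cl']; apply/eqP; rewrite eq_le.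
rewrite !leNgt; apply/andP; split; apply/negP => h.
  by have := cl' _ h; rewrite leNgt ca.
by have := cl _ h; rewrite leNgt ca'.
Qed.

Lemma Ralpha0 (a : L) : ozero a -> Ralpha a = [set 0].
Proof.
move=> a0; have nlt c : ~ (c < a)%O by rewrite ltNge a0.
rewrite RalphaE; apply/seteqP; split=> x /=; last by move=> ->; constructor.
case=> [[]//|[c [_ [/nlt]]]//|[c [/nlt]]//|[[]//]].
Qed.

Lemma Ralpha1 (c a : L) : ozero c -> osucc c a ->
  Ralpha a = range (fun r : F => r *: (1 : bhat)).
Proof.
move=> c0 ca; rewrite RalphaE; apply/seteqP; split=> x /=.
  case=> [[a0]|[e [_ _]]//|[e [_ [e0 ea]]]|[[_ /(_ c)]]//].
    by have := a0 c; rewrite leNgt; case: ca => ->.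
  by case: e0; rewrite (osucc_inj ea ca).
by move=> h; apply: Or42; exists c.
Qed.

Lemma RalphaS (c a : L) : ~ ozero c -> osucc c a -> Ralpha a = adjoin c (Ralpha c).
Proof.
move=> c0 ca; rewrite RalphaE; apply/seteqP; split=> x /=.
  case=> [[a0]|[e [e0 ea]]|[e [_ [_ ea]]]|[[_ /(_ c)]]//].
    by have := a0 c; rewrite leNgt; case: ca => ->.
    by case: c0; rewrite (osucc_inj ca ea).
  by rewrite (osucc_inj ca ea).
by move=> h; apply: Or43; exists c; case: (ca) => lt _; exists lt.
Qed.

Lemma Ralpha_limit (a : L) : olimit a ->
  Ralpha a = \bigcup_(c in [set c | (c < a)%O]) Ralpha c.
Proof.
move=> [a0 al]; rewrite RalphaE; apply/seteqP; split=> x /=.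
  case=> [[]//|[c [_ /al]]//|[c [_ [_ /al]]]//|[_ [c [ca h]]]].
  by exists c.
by move=> [c ca h]; apply: Or44; split=> //; exists c, ca.
Qed.

Lemma alg_span_submod (X : set bhat) : submodule (alg_span X).
Proof.
split; first by rewrite inE => N [[[N0 _] _] _]; move: N0; rewrite inE.
move=> r u v; rewrite !inE => Au Av N NA; have [[[_ Nl] _] _] := NA.
move: (Nl r u v); rewrite !inE; apply; [exact: Au|exact: Av].
Qed.

Lemma Ralpha_sub_submod (a : L) :
  (forall c, (c < a)%O -> Ralpha c `<=` Ralpha a) /\ submodule (Ralpha a).
Proof.
elim/(well_founded_ind wf): a => a IH.
have [a0|a0] := pselect (ozero a).
  split=> [c|]; first by rewrite ltNge a0.
  rewrite Ralpha0 //; split; first by rewrite inE.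
  by move=> r u v; rewrite !inE /= => -> ->; rewrite scaler0 addr0.
have [[c ca]|al] := pselect (exists c, osucc c a); last first.
  have la : olimit a by split=> // c ca; apply: al; exists c.
  have up c : (c < a)%O -> Ralpha c `<=` Ralpha a.
    by move=> ca x xc; rewrite Ralpha_limit //; exists c.
  split=> //; split.
    have [c ca] : exists c, (c < a)%O.
      by apply: contrapT => h; apply: a0 => c; rewrite leNgt; apply/negP => ca;
        apply: h; exists c.
    by have [_ []] := IH c ca; rewrite !inE => /(up _ ca).
  move=> r u v; rewrite !inE Ralpha_limit // => -[c ca uc] [e ea ve].
  have lin k : (k < a)%O -> Ralpha k u -> Ralpha k v ->
      (\bigcup_(c in [set c | (c < a)%O]) Ralpha c) (r *: u + v).
    move=> ka uk vk; exists k => //.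
    by have [_ [_ /(_ r u v)]] := IH k ka; rewrite !inE; apply.
  case: (ltgtP c e) => [ce|ec|ce].
  - by apply: (lin e) => //; have [h _] := IH e ea; apply: (h c ce).
  - by apply: (lin c) => //; have [h _] := IH c ca; apply: (h e ec).
  - by apply: (lin e) => //; rewrite -ce.
have lt_ca : (c < a)%O by case: ca.
suff [sub subm] : Ralpha c `<=` Ralpha a /\ submodule (Ralpha a).
  split=> // e ea; have : (e <= c)%O.
    by rewrite leNgt; apply/negP => /(proj2 ca); rewrite leNgt ea.
  rewrite le_eqVlt => /predU1P[->//|ec].
  by have [h _] := IH c lt_ca; apply: subset_trans (h e ec) sub.
have [c0|c0] := pselect (ozero c).
  rewrite (Ralpha0 c0) (Ralpha1 c0 ca); split=> [x ->|]; first by exists 0; rewrite ?scale0r.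
  split; first by rewrite inE; exists 0; rewrite ?scale0r.
  move=> r u v; rewrite !inE => -[x _ <-] [y _ <-].
  by exists (r * x + y); [|rewrite scalerDl -scalerA].
rewrite (RalphaS c0 ca); split; last exact: alg_span_submod.
by move=> x xc N [_]; apply; left; left.
Qed.

Lemma Ralpha_submod (a : L) : submodule (Ralpha a).
Proof. by have [] := Ralpha_sub_submod a. Qed.

End Construction.

(* Main.v *)
Require Import Defs.
From HB Require Import structures.
From mathcomp Require Import all_boot all_order all_algebra.
From mathcomp Require Import finmap monalg ring.
From mathcomp Require Import boolp classical_sets functions cardinality.
From mathcomp.multinomials Require mpoly.

(** At a fixed level n, replace every branch-like element y_{eta n x} by an
    indeterminate Y_eta.  Evaluation maps the polynomial ring in the z_tau and the
    Y_eta to the completion, and the level-n polynomials embed in those of a higher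
    level m by expanding Y_eta as a finite sum plus (q_m/q_n) Y_eta.  As the s_k are
    pairwise coprime, the completion of B is the product of the B / s_k B.  In the
    factor k >= n the image of Y_eta contains z_{eta|k} with the coefficient q_k/q_n,
    a unit modulo s_k; for large k the nodes eta|k of the finitely many branches in
    a polynomial p are distinct and new, so that p modulo s_k is recovered from its
    image.  Hence evaluation is injective, whatever the (nonunique) values of the
    tails in the early factors; R is an increasing union of polynomial rings, and
    R_alpha consists of the values of polynomials in the variables of index below
    alpha.

    Freeness is Pontryagin's criterion.  Given finitely many elements, choose a level
    n at which the nodes of their branches are distinct.  The expansion from level n
    to level m is split on polynomials in these branches by a retraction sending
    z_{eta|n}, which has coefficient 1, back to Y_eta; therefore the pure closure of
    the given elements still has level n, and coefficients of polynomials supply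
    enough functionals to separate its points. *)

Set Implicit Arguments.
Unset Strict Implicit.
Unset Printing Implicit Defensive.

Import Order.TTheory GRing.Theory.
Local Open Scope classical_set_scope.
Local Open Scope card_scope.
Local Open Scope ring_scope.

(** * Submodules and linear spans *)

Section Submodules.
Variables (F : comNzRingType) (M : lmodType F).
Implicit Types (A N : set M).

Lemma submodP N : submodule N <-> N 0 /\ forall c u v, N u -> N v -> N (c *: u + v).
Proof.
split=> [[N0 NL]|[N0 NL]].
  split; first by move: N0; rewrite inE.
  by move=> c u v Nu Nv; have := NL c u v; rewrite !inE; apply.
by split=> [|c u v]; rewrite !inE //; apply: NL.
Qed.

Lemma submod0 N : submodule N -> N 0.
Proof. by case/submodP. Qed.
Lemma submodD N u v : submodule N -> N u -> N v -> N (u + v).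
Proof. by case/submodP => _ NL Nu Nv; rewrite -[u]scale1r; apply: NL. Qed.
Lemma submodZ N c u : submodule N -> N u -> N (c *: u).
Proof. by case/submodP => N0 NL Nu; rewrite -[c *: u]addr0; apply: NL. Qed.
Lemma submodN N u : submodule N -> N u -> N (- u).
Proof. by rewrite -scaleN1r; apply: submodZ. Qed.
Lemma submodB N u v : submodule N -> N u -> N v -> N (u - v).
Proof. by move=> sN Nu Nv; apply: submodD => //; apply: submodN. Qed.
Lemma submod_sum N (I : eqType) (r : seq I) (E : I -> M) : submodule N ->
  (forall i, i \in r -> N (E i)) -> N (\sum_(i <- r) E i).
Proof.
move=> sN EN; rewrite big_seq; elim/big_ind: _ => //; first exact: submod0.
by move=> u v; apply: submodD.
Qed.

Lemma lspan_gen A : A `<=` lspan A.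
Proof. by move=> x Ax N [_]; apply. Qed.
Lemma lspan_sub A N : submodule N -> A `<=` N -> lspan A `<=` N.
Proof. by move=> sN AN x; apply. Qed.
Lemma lspan_mono A B : A `<=` B -> lspan A `<=` lspan B.
Proof.
move=> AB; apply: lspan_sub (lspan_submod B) _.
by apply: subset_trans (@lspan_gen B).
Qed.

End Submodules.

(** * Pontryagin's criterion *)

Section FreenessCriterion.
Variables (F : idomainType) (M : lmodType F).
Implicit Types (a : nat -> M) (U : set M).

(** A functional on [U] is a total function, arbitrary outside [U]; it can thus be defined through
    chosen representatives. *)
Definition lin_on U (phi : M -> F) :=
  forall c u v, U u -> U v -> phi (c *: u + v) = c * phi u + phi v.

(** For a submodule this is torsionlessness. *)
Definition separated U :=
  forall u, U u -> u != 0 -> exists2 phi, lin_on U phi & phi u != 0.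

Definition head_span a n := lspan [set a i | i in [set i | (i < n)%N]].

Lemma head_spanS a n u : head_span a n.+1 u ->
  exists c v, head_span a n v /\ u = c *: a n + v.
Proof.
apply: (@lspan_sub _ _ _ [set u | exists c v, head_span a n v /\ u = c *: a n + v]).
  apply/submodP; split.
    by exists 0, 0; rewrite scale0r addr0; split=> //; apply: submod0 (lspan_submod _).
  move=> c _ _ [d [x [hx ->]]] [e [y [hy ->]]].
  exists (c * d + e), (c *: x + y); split.
    by apply: submodD (lspan_submod _) _ hy; apply: submodZ (lspan_submod _) hx.
  by rewrite scalerDr scalerA scalerDl addrACA.
move=> _ [i /= + <-]; rewrite ltnS leq_eqVlt => /predU1P[->|ni].
  by exists 1, 0; rewrite scale1r addr0; split=> //; apply: submod0 (lspan_submod _).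
by exists 0, (a i); rewrite scale0r add0r; split=> //; apply: lspan_gen; exists i.
Qed.

Lemma head_span_le a m n : (m <= n)%N -> head_span a m `<=` head_span a n.
Proof.
by move=> mn; apply: lspan_mono => _ [i /= im <-]; exists i => //=; apply: leq_trans mn.
Qed.

Lemma head_span_gen a i n : (i < n)%N -> head_span a n (a i).
Proof. by move=> ni; apply: lspan_gen; exists i. Qed.

Lemma lin_on0 U phi : submodule U -> lin_on U phi -> phi 0 = 0.
Proof.
move=> sU lp; have := lp 1 0 0 (submod0 sU) (submod0 sU).
by rewrite scaler0 addr0 mul1r => /eqP; rewrite eq_sym addrC -subr_eq0 addrK => /eqP.
Qed.

(* Elimination of the coordinate [phi0] against the pivot [a n] turns a family
   of n.+1 vectors into one of n vectors, without leaving F. *)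
Lemma span_or_functional U a n v : submodule U -> separated U ->
  (forall i, U (a i)) -> U v ->
  (exists2 c, c != 0 & head_span a n (c *: v)) \/
  exists phi, [/\ lin_on U phi, forall i, (i < n)%N -> phi (a i) = 0 & phi v != 0].
Proof.
move=> sU sepU; elim: n a v => [|n IH] a v Ua Uv.
  have [->|v0] := eqVneq v 0.
    by left; exists 1; rewrite ?oner_neq0 // scaler0; apply: submod0 (lspan_submod _).
  by right; have [phi lp pv] := sepU v Uv v0; exists phi.
have [an0|an0] := eqVneq (a n) 0.
  have [[c c0 cv]|[phi [lp pa pv]]] := IH a v Ua Uv.
    by left; exists c => //; apply: head_span_le cv.
  right; exists phi; split=> // i; rewrite ltnS leq_eqVlt => /predU1P[->|]; last exact: pa.
  by rewrite an0 (lin_on0 sU lp).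
have [phi0 lp0 p0] := sepU _ (Ua n) an0.
pose p := phi0 (a n); pose red u := p *: u - phi0 u *: a n.
have Ured u : U u -> U (red u).
  by move=> Uu; apply: (submodB sU); apply: submodZ.
have [[c c0 cv]|[phi [lp pa pv]]] :=
    IH (red \o a) (red v) (fun i => Ured _ (Ua i)) (Ured _ Uv).
  left; exists (c * p); first by rewrite mulf_neq0.
  have sH := lspan_submod [set a i | i in [set i | (i < n.+1)%N]].
  have -> : (c * p) *: v = c *: red v + (c * phi0 v) *: a n.
    by rewrite scalerBr !scalerA subrK.
  apply: (submodD sH); last by apply: (submodZ _ sH); apply: head_span_gen.
  move: cv; apply: lspan_sub => // _ [i /= ni <-].
  by apply: (submodB sH); apply: (submodZ _ sH); apply: head_span_gen => //; apply: leqW.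
(* On [U] this is [phi] composed with [red], written out so that linearity and the vanishing at
   [a n] are visible. *)
right; exists (fun u => p * phi u - phi (a n) * phi0 u).
have redE u : U u -> phi (red u) = p * phi u - phi (a n) * phi0 u.
  move=> Uu; have := lp (- phi0 u) (a n) 0 (Ua n) (submod0 sU).
  rewrite addr0 (lin_on0 sU lp) addr0 => phian.
  rewrite /red -scaleNr lp ?phian ?mulNr 1?[phi0 u * _]mulrC //.
  exact: (submodZ _ sU).
split.
- by move=> c u w Uu Uw; rewrite lp // lp0 //; ring.
- move=> i; rewrite ltnS leq_eqVlt => /predU1P[->|ni]; first by rewrite mulrC subrr.
  by rewrite -redE //; apply: (pa i ni).
- by rewrite -redE.
Qed.

(** The pure closure of the first [n] members of the sequence inside the span of all of them. *)
Definition head_closure a n : set M := [set u |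
  lspan (range a) u /\ exists2 c, c != 0 & head_span a n (c *: u)].

Lemma head_closure_submod a n : submodule (head_closure a n).
Proof.
have sH := lspan_submod [set a i | i in [set i | (i < n)%N]].
have sR := lspan_submod (range a).
apply/submodP; split.
  split; first exact: submod0.
  by exists 1; rewrite ?oner_neq0 // scaler0; apply: (submod0 sH).
move=> c u v [Ru [d d0 hu]] [Rv [e e0 hv]]; split.
  by apply: (submodD sR) => //; apply: (submodZ _ sR).
exists (d * e); first by rewrite mulf_neq0.
rewrite scalerDr !scalerA; apply: (submodD sH).
  by have -> : d * e * c = e * c * d; [ring|rewrite -scalerA; apply: (submodZ _ sH)].
by rewrite -scalerA; apply: (submodZ _ sH).
Qed.

Lemma head_closure_le a m n : (m <= n)%N -> head_closure a m `<=` head_closure a n.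
Proof.
move=> mn u [Ru [c c0 hu]]; split=> //; exists c => //.
exact: head_span_le hu.
Qed.

Lemma head_closure_gen a i n : (i < n)%N -> head_closure a n (a i).
Proof.
move=> ni; split; first by apply: lspan_gen; exists i.
by exists 1; rewrite ?oner_neq0 // scale1r; apply: head_span_gen.
Qed.

Lemma head_closure_pure a n c u : c != 0 -> lspan (range a) u ->
  head_closure a n (c *: u) -> head_closure a n u.
Proof.
move=> c0 Ru [_ [d d0]]; rewrite scalerA => h; split=> //.
by exists (d * c) => //; rewrite mulf_neq0.
Qed.

Hypothesis F_pid : principal_ideal_domain F.

(** Consecutive closures differ by a torsion-free module of rank at most one. If the rank is one, a
    functional that kills the first [n] members but not [a n] maps it isomorphically onto an ideal
    of [F], and [e] lies over a generator of that ideal. *)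
Lemma head_closure_step a n : separated (head_closure a n.+1) ->
  exists e, [/\ head_closure a n.+1 e,
    e = 0 \/ (forall c, head_closure a n (c *: e) -> c = 0)
    & forall u, head_closure a n.+1 u -> exists t, head_closure a n (u - t *: e)].
Proof.
move=> sep; set U := head_closure a n.+1.
have sU := head_closure_submod a n.+1; have sN := head_closure_submod a n.
have sR := lspan_submod (range a).
have sH := lspan_submod [set a i | i in [set i | (i < n)%N]].
have an : U (a n) by apply: head_closure_gen.
(* The functional is sought for a sequence inside [U], which need not contain the later members;
   they are replaced by 0. *)
pose a' i := if (i < n)%N then a i else 0.
have a'a : head_span a' n = head_span a n.
  congr lspan; apply/seteqP; split=> _ [i /= ni <-]; exists i => //=;
    by rewrite /a' ni.
have Ua' i : U (a' i).
  rewrite /a'; case: ifP => ni; last exact: submod0.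
  by apply: head_closure_gen; apply: leqW.
have [[c c0]|[phi [lp pa pan]]] := span_or_functional n sU sep Ua' an.
  rewrite a'a => hc; exists 0; split; [exact: submod0|by left|].
  move=> u [Ru [d d0 /head_spanS [e [v [hv du]]]]]; exists 0.
  rewrite scale0r subr0; split=> //; exists (c * d); first by rewrite mulf_neq0.
  rewrite -scalerA du scalerDr scalerA; apply: (submodD sH); last exact: (submodZ _ sH).
  by rewrite mulrC -scalerA; apply: (submodZ _ sH).
have phiH u : head_span a n u -> phi u = 0.
  suff : head_span a n `<=` [set u | U u /\ phi u = 0] by move=> h /h [].
  apply: lspan_sub.
    apply/submodP; split; first by split; [exact: submod0|exact: lin_on0 lp].
    move=> c x y [Ux px] [Uy py]; split.
      by apply: (submodD sU) => //; apply: (submodZ _ sU).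
    by rewrite lp // px py mulr0 addr0.
  move=> _ [i /= ni <-]; split; first by apply: head_closure_gen; apply: leqW.
  by have := pa i ni; rewrite /a' ni.
have phi0 := lin_on0 sU lp.
have phiZ c u : U u -> phi (c *: u) = c * phi u.
  by move=> Uu; rewrite -[c *: u]addr0 lp ?phi0 ?addr0 //; apply: submod0.
have hU : head_span a n `<=` U.
  move=> u hu; apply: (head_closure_le (leqnSn n)); split.
    by move: hu; apply: lspan_mono => _ [i _ <-]; exists i.
  by exists 1; rewrite ?oner_neq0 ?scale1r.
(* The kernel of [phi] on [U] is the previous closure: a multiple of [u] is [e *: a n] plus a member
   of the head span, and [phi] sees only [e]. *)
have kerN u : U u -> (phi u = 0 <-> head_closure a n u).
  move=> [Ru [c c0 /head_spanS [e [v [hv cu]]]]].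
  have Uu : U u.
    by apply: (head_closure_pure c0) => //; rewrite cu; apply: (submodD sU);
      [apply: (submodZ _ sU)|apply: hU].
  have cphi : c * phi u = e * phi (a n).
    by rewrite -(phiZ c) // cu lp ?(phiH _ hv) ?addr0 //; apply: hU.
  split=> [pu|[_ [b b0 hb]]].
    move: cphi; rewrite pu mulr0 => /esym/eqP; rewrite mulf_eq0 (negbTE pan) orbF => /eqP e0.
    by split=> //; exists c => //; rewrite cu e0 scale0r add0r.
  by have := phiH _ hb; rewrite phiZ // => /eqP; rewrite mulf_eq0 (negbTE b0) => /eqP.
have [g Jg] : exists g, phi @` U = range (fun r => g * r).
  apply: F_pid; split; first by exists 0 => //; apply: submod0.
  move=> c _ _ [u Uu <-] [v Uv <-]; exists (c *: u + v); last by rewrite lp.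
  by apply: (submodD sU) => //; apply: (submodZ _ sU).
have [e Ue pe] : (phi @` U) g by rewrite Jg; exists 1; rewrite ?mulr1.
have g0 : g != 0.
  have : (phi @` U) (phi (a n)) by exists (a n).
  by rewrite Jg => -[r _ gr]; apply: contra pan => /eqP g0; rewrite -gr g0 mul0r.
exists e; split=> //.
  right=> c /(proj2 (kerN _ (submodZ c sU Ue))).
  by rewrite phiZ // pe => /eqP; rewrite mulf_eq0 (negbTE g0) orbF => /eqP.
move=> u Uu; have : (phi @` U) (phi u) by exists u.
rewrite Jg => -[t _ gt]; exists t; apply/kerN.
  by apply: (submodB sU) => //; apply: (submodZ _ sU).
rewrite addrC -scaleNr lp // pe -gt; ring.
Qed.

(** The nonzero vectors [e n] form a basis. They span because each closure is the previous one plus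
    the multiples of one [e n]; in a relation the term of largest index lies in the closure before
    it, which forces its coefficient to be 0. *)
Lemma free_of_separated a : (forall n, separated (head_closure a n)) ->
  free_module (lspan (range a)).
Proof.
move=> sep; have /choice [e eP] n := head_closure_step (sep n.+1).
have sN n := head_closure_submod a n.
have eN n : head_closure a n.+1 (e n) by case: (eP n).
pose X := [set x | x != 0 /\ exists n, x = e n]; exists X; last first.
  have sX := lspan_submod X; apply/seteqP; split.
    apply: lspan_sub (lspan_submod _) _ => _ [_ [n ->]].
    by have [] := eN n.
  have NX n : head_closure a n `<=` lspan X.
    elim: n => [u [Ru [c c0 cu]]|n IH u].
      have [->|u0] := eqVneq u 0; first exact: submod0.
      have hu : head_closure a 0 u by split=> //; exists c.
      (* Separation excludes torsion, so the closure of no vectors is zero. *)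
      have [phi lp /negP[]] := sep 0%N u hu u0.
      have cu0 : c *: u = 0.
        by move: cu; apply: (@lspan_sub _ _ _ [set 0]) => [|_ []//];
          apply/submodP; split=> // d _ _ -> ->; rewrite scaler0 addr0.
      have := lp c u 0 hu (submod0 (sN 0%N)).
      rewrite cu0 addr0 (lin_on0 (sN _) lp) addr0 => /esym/eqP.
      by rewrite mulf_eq0 (negbTE c0).
    have [_ _ /[apply] [[t /IH ut]]] := eP n.
    rewrite -[u](subrK (t *: e n)); apply: (submodD sX) => //; apply: (submodZ _ sX).
    have [->|en] := eqVneq (e n) 0; first exact: submod0.
    by apply: lspan_gen; split=> //; exists n.
  by apply: lspan_sub => // _ [n _ <-]; apply: (NX n.+1); apply: head_closure_gen.
move=> r c ur rX r0.
have /choice [k kP] x : exists n, X x -> x = e n.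
  by case: (pselect (X x)) => [[_ [n ->]]|]; [exists n|exists 0%N].
have [m mP] : exists m, forall x, x \in r -> (k x < m)%N.
  exists (\max_(x <- r) (k x).+1) => x xr.
  exact: (@leq_bigmax_seq _ r xpredT (fun x => (k x).+1)).
(* Descending induction on the index: [j] bounds the distance from [n] up to [m]. *)
suff H j n x : (m - n <= j)%N -> x \in r -> (n <= k x)%N -> c x = 0.
  by move=> x xr; apply: (H (m - k x)%N (k x)).
elim: j n x => [|j IH] n x mn xr nk.
  by have := mP x xr; move: mn; rewrite leqn0 subn_eq0 ltnNge => /leq_trans -> //.
have big y : y \in r -> (n < k y)%N -> c y = 0.
  by apply: IH; rewrite subnS; move: mn; case: (m - n)%N.
move: nk; rewrite leq_eqVlt => /predU1P[nk|]; last exact: big.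
have xE := kP x (rX x xr).
have [_ [x0|xi] _] := eP (k x).
  by have [] := rX x xr; rewrite {1}xE x0 eqxx.
apply: xi; rewrite -xE.
move/eqP: r0; rewrite (bigD1_seq x) //= addr_eq0 => /eqP ->.
apply: (submodN (sN _)); rewrite -big_filter; apply: submod_sum => // y.
rewrite mem_filter => /andP[yx yr].
case: (ltngtP (k y) (k x)) => kk.
- apply: (submodZ _ (sN _)); rewrite (kP y (rX y yr)).
  exact: (head_closure_le kk).
- by rewrite big ?nk // scale0r; apply: submod0.
- by case/eqP: yx; rewrite (kP y (rX y yr)) kk -xE.
Qed.

Lemma aleph1_free_of_separated (N : set M) : submodule N ->
  (forall a, range a `<=` N -> forall n, separated (head_closure a n)) ->
  aleph1_free N.
Proof.
move=> sN sep A AN /pcard_leP [f].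
(* Positions that code no element of [A] hold 0, which does not change the span. *)
have /choice [a aP] : forall n, exists x, (A x /\ f x = n) \/
    (x = 0 /\ ~ exists x, A x /\ f x = n).
  move=> n; case: (pselect (exists x, A x /\ f x = n)) => [[x h]|h].
    by exists x; left.
  by exists 0; right.
have <- : lspan (range a) = lspan A.
  apply/seteqP; split; apply: lspan_sub; try exact: lspan_submod.
    move=> _ [n _ <-]; case: (aP n) => [[h _]|[-> _]]; first exact: lspan_gen.
    by apply: submod0 (lspan_submod _).
  move=> x Ax; apply: lspan_gen; exists (f x) => //.
  case: (aP (f x)) => [[Ay]|[_ []]]; last by exists x.
  by move=> /(@inj _ _ _ f) -> //; rewrite inE.
apply: free_of_separated; apply: sep => _ [n _ <-].
by case: (aP n) => [[/AN]|[-> _]] //; apply: submod0.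
Qed.

End FreenessCriterion.

Local Notation "1" := (@mone _) : monom_scope.
Local Notation "x * y" := (mmul x y) : monom_scope.

(** * Evaluation of polynomials in a commutative ring *)

Section Evaluation.
Variables (K : choiceType) (F : comNzRingType) (A : comPzRingType).
Variables (f : {rmorphism F -> A}) (h : K -> A).
Local Notation P := {malg F[{cmonom K}]}.

Definition mon_eval (m : {cmonom K}) : A := \prod_(k <- finsupp m) h k ^+ m k.

Lemma mon_evalEw (m : {cmonom K}) (D : {fset K}) : (finsupp m `<=` D)%fset ->
  mon_eval m = \prod_(k <- D) h k ^+ m k.
Proof.
move=> mD; rewrite /mon_eval; apply/esym.
rewrite (big_fsetID _ (fun k => k \in finsupp m)) /= [X in _ * X]big_seq_cond.
rewrite [X in _ * X]big1 ?mulr1.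
  apply: eq_fbigl => k; rewrite !inE /=.
  case: (boolP (k \in finsupp m)) => h1; rewrite ?andbF // andbT.
  by rewrite (fsubsetP mD).
move=> k; rewrite !inE /= andbT => /andP[_]; rewrite -cmE_eq0 => /eqP ->.
by rewrite expr0.
Qed.

Lemma mon_eval1 : mon_eval 1%M = 1.
Proof. by rewrite /mon_eval mdom1 big_seq_fset0. Qed.

Lemma mon_evalU k : mon_eval (ucm k) = h k.
Proof. by rewrite /mon_eval mdomU big_seq_fset1 cmUU expr1. Qed.

Lemma mon_evalM m n : mon_eval (m * n)%M = mon_eval m * mon_eval n.
Proof.
rewrite (@mon_evalEw _ (finsupp m `|` finsupp n)%fset) ?mdomD //.
rewrite (@mon_evalEw m (finsupp m `|` finsupp n)%fset) ?fsubsetUl //.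
rewrite (@mon_evalEw n (finsupp m `|` finsupp n)%fset) ?fsubsetUr //.
by rewrite -big_split /=; apply: eq_bigr => k _; rewrite cmM exprD.
Qed.

(* The key keeps unification from unfolding evaluations. *)
Fact malgev_key : unit. Proof. by []. Qed.
Definition malgev : P -> A :=
  locked_with malgev_key (fun p => \sum_(m <- msupp p) f p@_m * mon_eval m).

Lemma malgevEw (p : P) (D : {fset {cmonom K}}) : (msupp p `<=` D)%fset ->
  malgev p = \sum_(m <- D) f p@_m * mon_eval m.
Proof.
move=> pD; rewrite /malgev unlock; apply/esym.
rewrite (big_fsetID _ (fun k => k \in msupp p)) /= [X in _ + X]big_seq_cond.
rewrite [X in _ + X]big1 ?addr0.
  apply: eq_fbigl => k; rewrite !inE /=.
  case: (boolP (k \in msupp p)) => h1; rewrite ?andbF // andbT.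
  by rewrite (fsubsetP pD).
move=> k; rewrite !inE /= andbT => /andP[_]; rewrite -mcoeff_eq0 => /eqP ->.
by rewrite rmorph0 mul0r.
Qed.

Lemma malgev_zmod_morphism : zmod_morphism malgev.
Proof.
move=> p q; pose D := (msupp p `|` msupp q)%fset.
rewrite (@malgevEw p D) ?fsubsetUl // (@malgevEw q D) ?fsubsetUr //.
rewrite (@malgevEw (p - q) D) ?msuppB_le // -sumrB; apply: eq_bigr => m _.
by rewrite mcoeffB rmorphB mulrBl.
Qed.
HB.instance Definition _ :=
  GRing.isZmodMorphism.Build P A malgev malgev_zmod_morphism.

Lemma malgev_sum I (r : seq I) (E : I -> P) :
  malgev (\sum_(i <- r) E i) = \sum_(i <- r) malgev (E i).
Proof. exact: (raddf_sum malgev). Qed.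

Lemma malgevU c m : malgev << c *g m >> = f c * mon_eval m.
Proof.
by rewrite (@malgevEw _ [fset m]%fset) ?msuppU_le // big_seq_fset1 mcoeffUU.
Qed.

Lemma malgev_monoid_morphism : monoid_morphism malgev.
Proof.
split=> [|p q].
  by rewrite -[1]/(<< _ *g _ >>) malgevU rmorph1 mon_eval1 mulr1.
rewrite [p * q]malgME malgev_sum.
rewrite (malgevEw (fsubset_refl (msupp p))) (malgevEw (fsubset_refl (msupp q))) mulr_suml.
apply: eq_bigr => m _; rewrite malgev_sum mulr_sumr.
by apply: eq_bigr => n _; rewrite malgevU mon_evalM rmorphM mulrACA.
Qed.
HB.instance Definition _ :=
  GRing.isMonoidMorphism.Build P A malgev malgev_monoid_morphism.

Lemma malgevC c : malgev c%:MP = f c.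
Proof. by rewrite malgevU mon_eval1 mulr1. Qed.

Lemma malgevX k : malgev << ucm k >> = h k.
Proof. by rewrite malgevU rmorph1 mul1r mon_evalU. Qed.

Lemma malgevZ c p : malgev (c *: p) = f c * malgev p.
Proof. by rewrite -mul_malgC rmorphM /= malgevC. Qed.

End Evaluation.

(** * Polynomials with prescribed monomials *)

Section Support.
Variables (K : choiceType) (F : comNzRingType).
Local Notation P := {malg F[{cmonom K}]}.
Implicit Types (Q : {cmonom K} -> Prop) (G : K -> Prop) (p q : P).

(** The condition is on monomials, so that one notion covers both kernels met later: the zero
    polynomial, with [Q] false, and the polynomials in a set of variables, with [mon_in G]. *)
Definition supp_in Q p := forall m, m \in msupp p -> Q m.
Definition mon_in G (m : {cmonom K}) := forall k, m k != 0%N -> G k.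
Definition poly_in G := supp_in (mon_in G).

Lemma supp_inE Q p : supp_in Q p <-> forall m, ~ Q m -> p@_m = 0.
Proof.
split=> [pQ m nQ|pQ m]; first by apply: mcoeff_outdom; apply/negP => /pQ.
by move=> mp; apply: contrapT => /pQ /eqP; apply/negP; rewrite mcoeff_neq0.
Qed.

Lemma supp_in0 Q : supp_in Q 0.
Proof. by apply/supp_inE => m _; rewrite mcoeff0. Qed.

Lemma supp_inD Q p q : supp_in Q p -> supp_in Q q -> supp_in Q (p + q).
Proof.
move=> /supp_inE pQ /supp_inE qQ; apply/supp_inE => m nQ.
by rewrite mcoeffD pQ // qQ // addr0.
Qed.

Lemma supp_inZ Q c p : supp_in Q p -> supp_in Q (c *: p).
Proof.
by move=> /supp_inE pQ; apply/supp_inE => m nQ; rewrite mcoeffZ pQ // mulr0.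
Qed.

Lemma supp_inN Q p : supp_in Q p -> supp_in Q (- p).
Proof. by rewrite -scaleN1r; apply: supp_inZ. Qed.

Lemma supp_inB Q p q : supp_in Q p -> supp_in Q q -> supp_in Q (p - q).
Proof. by move=> ? ?; apply: supp_inD => //; apply: supp_inN. Qed.

Lemma supp_in_sum Q (I : Type) (r : seq I) (E : I -> P) :
  (forall i, supp_in Q (E i)) -> supp_in Q (\sum_(i <- r) E i).
Proof.
by move=> EQ; elim/big_ind: _ => //; [exact: supp_in0|exact: supp_inD].
Qed.

Lemma poly_inC G c : poly_in G c%:MP.
Proof.
by move=> m /(fsubsetP (msuppC_le _)); rewrite inE => /eqP -> k; rewrite cm1.
Qed.

Lemma poly_inX G k : G k -> poly_in G << ucm k >>.
Proof.
move=> Gk m /(fsubsetP msuppU_le); rewrite inE => /eqP -> j; rewrite cmU.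
by case: (k =P j) => [<-|].
Qed.

Lemma poly_inM G p q : poly_in G p -> poly_in G q -> poly_in G (p * q).
Proof.
move=> pG qG m /msuppM_le [m1 [m2 [m1p m2q ->]]] k; rewrite cmM addn_eq0 negb_and.
by case/orP; [apply: pG|apply: qG].
Qed.

Lemma poly_in_sub G G' p : (forall k, G k -> G' k) -> poly_in G p -> poly_in G' p.
Proof. by move=> GG' pG m mp k mk; apply/GG'/(pG m). Qed.

Lemma malgX_inj (k k' : K) : << ucm k >> = << ucm k' >> :> P -> k = k'.
Proof.
move=> kk'; have : (<< ucm k >> : P)@_(ucm k) = 1 := mcoeffUU _ _; rewrite kk'.
have -> : (<< ucm k' >> : P)@_(ucm k) = 1 *+ (ucm k' == ucm k) := mcoeffU _ _ _.
case: eqP => [e _|_ /eqP]; last by rewrite mulr0n eq_sym oner_eq0.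
by have := cmUU k; rewrite -e cmU; case: (k' =P k).
Qed.

Lemma malgUM c (m n : {cmonom K}) : << c *g m >> * << n >> = << c *g (m * n)%M >> :> P.
Proof. by rewrite [LHS]fgmulUU mulr1. Qed.

Lemma poly_in_ind G (T : P -> Prop) :
  (forall c, T c%:MP) -> (forall k, G k -> T << ucm k >>) ->
  (forall p q, T p -> T q -> T (p + q)) -> (forall p q, T p -> T q -> T (p * q)) ->
  forall p, poly_in G p -> T p.
Proof.
move=> TC TX TD TM p pG; rewrite (monalgE p).
have T0 : T 0 by rewrite -malgC0E; apply: TC.
have T1 : T 1 by apply: TC.
rewrite big_seq; apply: (big_ind T T0 TD) => m mp.
have -> : << p@_m *g m >> = (p@_m)%:MP * \prod_(k <- finsupp m) << ucm k >> ^+ m k :> P.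
  have -> : \prod_(k <- finsupp m) << ucm k >> ^+ m k = << m >> :> P.
    have Xn (x : {cmonom K}) n : exists2 y : {cmonom K}, << x >> ^+ n = << y >> :> P
        & forall i, y i = (x i * n)%N.
      elim: n => [|n [y yE yi]]; first by exists 1%M => // i; rewrite muln0 cm1.
      exists (x * y)%M; first by rewrite exprS yE; apply: malgUM.
      by move=> i; rewrite cmM yi mulnS.
    have Xp (r : seq K) : uniq r -> exists2 y : {cmonom K},
        \prod_(k <- r) << ucm k >> ^+ m k = << y >> :> P
        & forall i, y i = (if i \in r then m i else 0)%N.
      elim: r => [_|k r IH /= /andP[kr /IH [y yE yi]]].
        by exists 1%M => [|i]; rewrite ?big_nil // cm1.
      have [x xE xi] := Xn (ucm k) (m k).
      exists (x * y)%M.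
        by rewrite big_cons [X in (X * _)%R]xE [X in (_ * X)%R]yE; apply: malgUM.
      move=> i; rewrite cmM xi yi cmU inE eq_sym.
      by case: eqVneq => [->|_] /=; rewrite ?(negbTE kr) ?mul1n ?addn0.
    have [y -> yi] := Xp (finsupp m) (fset_uniq _); congr << _ >>.
    apply/eqP/cmP => i; rewrite yi; case: ifPn => //.
    by rewrite -cmE_eq0 => /eqP.
  have E : (1 * m)%M = m := mul0cm m.
  by have := malgUM (p@_m) 1%M m; rewrite E => ->.
apply: (TM); first exact: TC.
rewrite big_seq; apply: (big_ind T T1 TM) => k km.
have Tk : T << ucm k >> by apply/TX/(pG m) => //; rewrite cmE_neq0.
by elim: (m k) => [|n IH]; rewrite ?expr0 // exprS; apply: TM.
Qed.

(** The second clause makes [D] the exact list of occurring variables, so a property of all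
    variables of [p] holds on [D]. *)
Lemma poly_in_keys p : exists2 D : seq K, poly_in (fun k => k \in D) p &
  forall G, poly_in G p -> forall k, k \in D -> G k.
Proof.
exists (flatten (map (fun m : {cmonom K} => enum_fset (finsupp m)) (enum_fset (msupp p)))).
  move=> m mp k mk; apply/flattenP; exists (enum_fset (finsupp m)).
    by apply/mapP; exists m.
  by rewrite -[_ \in _]/(k \in finsupp m) -cmE_neq0.
move=> G pG k /flattenP [r /mapP [m mp ->] km].
by apply: (pG m) => //; rewrite cmE_neq0.
Qed.

Lemma poly_in_true p : poly_in (fun=> True) p.
Proof. by []. Qed.

End Support.

Lemma poly_in_malgev (K K' : choiceType) (F : comNzRingType) (G : K -> Prop)
    (G' : K' -> Prop) (h : K -> {malg F[{cmonom K'}]}) p :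
  (forall k, G k -> poly_in G' (h k)) -> poly_in G p ->
  poly_in G' (malgev (@malgC {cmonom K'} F) h p).
Proof.
move=> hG; elim/poly_in_ind => [c|k Gk|q r|q r].
- by rewrite malgevC; apply: poly_inC.
- by rewrite malgevX; apply: hG.
- by rewrite rmorphD; apply: supp_inD.
- by rewrite rmorphM; apply: poly_inM.
Qed.

(** * Polynomial rings have no zero divisors *)

Section Integral.
Import -(notations) mpoly.

(** Both factors involve only the finitely many variables in [D]; [H] moves them to a polynomial
    ring in [size D] variables, which is a domain, and [Hi] brings them back. *)
Lemma malg_integral (K : choiceType) (F : idomainType) (p q : {malg F[{cmonom K}]}) :
  p * q = 0 -> p = 0 \/ q = 0.
Proof.
move=> pq0; have [Dp pD _] := poly_in_keys p; have [Dq qD _] := poly_in_keys q.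
(* Without variables both polynomials are constants. Otherwise [D] supplies a default variable and a
   nonempty index type. *)
pose D := Dp ++ Dq; case: (posnP (size D)) => [D0|D0].
  have nin r : poly_in (fun k => k \in D) r -> exists c, r = c%:MP.
    elim/poly_in_ind => [c|k|_ _ [c ->] [d ->]|_ _ [c ->] [d ->]].
    - by exists c.
    - by rewrite (size0nil D0).
    - by exists (c + d); rewrite rmorphD.
    - by exists (c * d); rewrite rmorphM.
  have [c pc] : exists c, p = c%:MP.
    by apply: nin; apply: poly_in_sub pD => k kD; rewrite mem_cat kD.
  have [d' qc] : exists c, q = c%:MP.
    by apply: nin; apply: poly_in_sub qD => k kD; rewrite mem_cat kD orbT.
  move: pq0; rewrite pc qc -rmorphM /= => /eqP; rewrite -malgC0E malgC_eq mulf_eq0.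
  by case/orP => /eqP ->; [left|right]; rewrite malgC0E.
pose n := (size D).-1; have nE : n.+1 = size D by rewrite /n prednK.
pose h (k : K) : mpoly n.+1 F := mpolyX F (mnm1 (inord (index k D))).
have k0 : K by case: D D0 {n nE h} => // k.
pose g (i : 'I_n.+1) : {malg F[{cmonom K}]} := << ucm (nth k0 D i) >>.
pose H := malgev (@mpolyC n.+1 F) h.
pose Hi := mpoly.mmap (@malgC {cmonom K} F) g.
have HK r : poly_in (fun k => k \in D) r -> Hi (H r) = r.
  elim/poly_in_ind => [c|k kD|x y|x y].
  - by rewrite /H malgevC /Hi mpoly.mmapC.
  - rewrite /H malgevX /h /Hi mpoly.mmapX mpoly.mmap1U /g inordK ?nth_index //.
    by rewrite nE index_mem.
  - by rewrite /H /Hi !rmorphD /= => -> ->.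
  - by rewrite /H /Hi !rmorphM /= => -> ->.
have : H p * H q = 0 by rewrite -rmorphM pq0 rmorph0.
move/eqP; rewrite mulf_eq0 => /orP[] /eqP H0; [left|right].
  rewrite -[p]HK; first by rewrite H0 /Hi rmorph0.
  by apply: poly_in_sub pD => k kD; rewrite mem_cat kD.
rewrite -[q]HK; first by rewrite H0 /Hi rmorph0.
by apply: poly_in_sub qD => k kD; rewrite mem_cat kD orbT.
Qed.

End Integral.

(** * Congruence modulo a scalar *)

Section Congruence.
Variables (F : comNzRingType) (A : comAlgType F) (d : F).
Implicit Types x y z : A.

(** With [d = 0] this is equality; one statement thus covers inverses modulo [s k] and exact
    ones. *)
Definition dcong x y := exists z, x - y = d *: z.

Lemma dcong_refl x : dcong x x.
Proof. by exists 0; rewrite subrr scaler0. Qed.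
Lemma dcong_sym x y : dcong x y -> dcong y x.
Proof. by case=> z h; exists (- z); rewrite scalerN -h opprB. Qed.
Lemma dcong_trans y x z : dcong x y -> dcong y z -> dcong x z.
Proof. by case=> a h [c k]; exists (a + c); rewrite scalerDr -h -k addrA subrK. Qed.
Lemma dcongD x y x' y' : dcong x y -> dcong x' y' -> dcong (x + x') (y + y').
Proof. by case=> a h [c k]; exists (a + c); rewrite scalerDr -h -k opprD addrACA. Qed.
Lemma dcongM x y x' y' : dcong x y -> dcong x' y' -> dcong (x * x') (y * y').
Proof.
case=> a h [c k]; exists (a * x' + y * c).
by rewrite scalerDr scalerAl scalerAr -h -k mulrBl mulrBr addrA subrK.
Qed.

End Congruence.

(** * Divisibility by coprime factors *)

Section Divisibility.
Variables (F : idomainType) (s : nat -> F).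
Hypothesis S_coprime : pairwise_coprime s.

Lemma qquot_last n k : (n <= k)%N -> qquot s n k.+1 = qquot s n k * s k.
Proof. by move=> nk; rewrite /qquot big_nat_recr. Qed.

(** The quotient q_k/q_n divides q_k, which is coprime to [s k]; so it is a unit modulo [s k]. *)
Lemma qquot_inv n k : (n <= k)%N -> exists u v, u * qquot s n k - 1 = s k * v.
Proof.
move=> nk; have [a [c ac]] := coprime_q S_coprime (leqnn k).
exists (c * q s n), (- a); rewrite -[X in _ - X]ac -(qquotP s nk); ring.
Qed.

Lemma q_neq0 n : (forall k, s k != 0) -> q s n != 0.
Proof. by move=> s0; elim: n => [|n IH] /=; rewrite ?oner_neq0 // mulf_neq0. Qed.

(** Coprime divisors multiply: [c] is divisible by every [qquot s n k], hence [q s n * c] by every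
    [q s k], and the Hausdorff property applies. *)
Lemma eq0_of_divisible c n : (forall k, s k != 0) -> S_hausdorff s ->
  (forall k, (n <= k)%N -> exists r, c = s k * r) -> c = 0.
Proof.
move=> s0 haus hc; suff : q s n * c = 0.
  by move/eqP; rewrite mulf_eq0 (negbTE (q_neq0 _ s0)) => /eqP.
have qq k : (n <= k)%N -> exists r, c = qquot s n k * r.
  elim: k => [|k IH].
    by rewrite leqn0 => /eqP ->; exists c; rewrite /qquot big_geq ?mul1r.
  rewrite leq_eqVlt => /predU1P[<-|]; first by exists c; rewrite /qquot big_geq ?mul1r.
  rewrite ltnS => nk; have [r cr] := IH nk; have [r' cr'] := hc k nk.
  have [u [v uv]] := qquot_inv nk; exists (u * r' - v * r).
  rewrite qquot_last // mulrBr.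
  have -> : qquot s n k * s k * (u * r') = (u * qquot s n k) * c by rewrite cr'; ring.
  have -> : qquot s n k * s k * (v * r) = (s k * v) * c by rewrite [in RHS]cr; ring.
  by rewrite -uv; ring.
apply: haus => k; case: (leqP n k) => nk.
  by have [r ->] := qq k nk; exists r; rewrite -(qquotP s nk); ring.
by exists (qquot s k n * c); rewrite -(qquotP s (ltnW nk)); ring.
Qed.

End Divisibility.

(** * The factors of the completion *)

Section CompletionMorphisms.
Variables (F : idomainType) (s : nat -> F) (A : comAlgType F).
Local Notation cA := (completion s A).

Lemma cscale_mul1 c (u : cA) : c *: u = c *: (1 : cA) * u.
Proof. by rewrite -[RHS]cscaleAl mul1r. Qed.

Definition scalar_emb (c : F) : cA := c *: (1 : cA).

Lemma scalar_emb_zmod : zmod_morphism scalar_emb.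
Proof. by move=> c d; rewrite /scalar_emb scalerBl. Qed.
HB.instance Definition _ :=
  GRing.isZmodMorphism.Build F cA scalar_emb scalar_emb_zmod.

Lemma scalar_emb_monoid : monoid_morphism scalar_emb.
Proof.
split=> [|c d]; first by rewrite /scalar_emb scale1r.
by rewrite /scalar_emb -scalerA cscale_mul1.
Qed.
HB.instance Definition _ :=
  GRing.isMonoidMorphism.Build F cA scalar_emb scalar_emb_monoid.

Lemma emb_zmod : zmod_morphism (@emb F s A).
Proof.
move=> x y; apply: completion_ext => n; apply: scong_trans (embE _ _ _) _.
apply: scong_sym; apply: scong_trans (caddE _ _ _) _; apply: scongD; first exact: embE.
apply: scong_trans (coppE _ _) _; apply: scongN; exact: embE.
Qed.
HB.instance Definition _ :=
  GRing.isZmodMorphism.Build A cA (@emb F s A) emb_zmod.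

Lemma emb_monoid : monoid_morphism (@emb F s A).
Proof.
split=> [//|x y]; apply: completion_ext => n; apply: scong_trans (embE _ _ _) _.
apply: scong_sym; apply: scong_trans (cmulE _ _ _) _; apply: scongM; exact: embE.
Qed.
HB.instance Definition _ :=
  GRing.isMonoidMorphism.Build A cA (@emb F s A) emb_monoid.

Lemma embZ c x : emb s (c *: x) = scalar_emb c * emb s x :> cA.
Proof.
rewrite /scalar_emb -cscale_mul1.
apply: completion_ext => n; apply: scong_trans (embE _ _ _) _.
apply: scong_sym; apply: scong_trans (cscaleE _ _ _) _; apply: scongZ; exact: embE.
Qed.

(* The completion is the product of the [A / s k A]; [at_factor k u x] says that
   [x] represents the factor of index [k] of [u]. *)
Definition at_factor k (u : cA) (x : A) := dcong (s k) (u k.+1) x.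

(** The modulus [q s k.+1] is a multiple of [s k]; hence the factor of index [k] is read off at
    level [k.+1]. *)
Lemma dcong_scong k (x y : A) : scong s k.+1 x y -> dcong (s k) x y.
Proof. by case=> z h; exists (q s k *: z); rewrite h scalerA. Qed.

Lemma at_factor_emb k x : at_factor k (emb s x) x.
Proof. exact/dcong_scong/embE. Qed.

Lemma at_factorD k u v x y :
  at_factor k u x -> at_factor k v y -> at_factor k (u + v) (x + y).
Proof.
move=> ux vy; apply: dcong_trans (dcong_scong (caddE _ _ _)) _.
exact: dcongD.
Qed.

Lemma at_factorM k u v x y :
  at_factor k u x -> at_factor k v y -> at_factor k (u * v) (x * y).
Proof.
move=> ux vy; apply: dcong_trans (dcong_scong (cmulE _ _ _)) _.
exact: dcongM.
Qed.

Lemma at_factorZ k c u x : at_factor k u x -> at_factor k (c *: u) (c *: x).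
Proof.
move=> [z ux]; apply: dcong_trans (dcong_scong (cscaleE _ _ _)) _.
by exists (c *: z); rewrite -scalerBr ux !scalerA mulrC.
Qed.

Lemma at_factor_sum k (r : seq nat) (U : nat -> cA) (X : nat -> A) :
  (forall i, at_factor k (U i) (X i)) ->
  at_factor k (\sum_(i <- r) U i) (\sum_(i <- r) X i).
Proof.
move=> UX; elim/big_ind2: _ => //; first exact: at_factor_emb.
by move=> u x v y; apply: at_factorD.
Qed.

Lemma at_factor_torsion k u : at_factor k (s k *: u) 0.
Proof.
apply: dcong_trans (dcong_scong (cscaleE _ _ _)) _.
by exists (u k.+1); rewrite subr0.
Qed.

(** The relations between tails are linear, so each y_{eta n x} is the tail of a single series. *)
Lemma tail_series_lincomb (u v w z : nat -> cA) (X : cA) :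
  tail_series u w -> tail_series v z ->
  tail_series (fun i => u i + X * v i) (fun i => w i + X * z i).
Proof.
move=> uw vz; apply/tail_seriesP => n.
rewrite (proj1 (tail_seriesP _ _) uw n) (proj1 (tail_seriesP _ _) vz n).
rewrite mulrDr addrACA scalerDr; congr (_ + (_ + _)).
by rewrite mulrC -cscaleAl mulrC.
Qed.

(** The remainder after index [k] carries the coefficient q_{k+1}/q_n, a multiple of [s k]; the
    factor therefore does not depend on the choice of the tails. *)
Lemma tail_series_factor (u w : nat -> cA) (x : nat -> A) n k :
  tail_series u w -> (n <= k)%N -> (forall i, at_factor k (u i) (x i)) ->
  at_factor k (w n) (\sum_(n <= i < k.+1) qquot s n i *: x i).
Proof.
move=> uw nk ux; rewrite (uw n k.+1 (leqW nk)) -[X in at_factor _ _ X]addr0.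
apply: at_factorD; first by apply: at_factor_sum => i; apply: at_factorZ.
rewrite qquot_last // mulrC -scalerA; exact: at_factor_torsion.
Qed.

End CompletionMorphisms.

(** * Formal branch-like elements *)

Section FormalVariables.
Variables (d : Order.disp_t) (L : orderType d) (C : L -> set nat).

Definition tree_branch := {a : L & branch (C a)}.

(* The second kind of variable stands for the branch-like elements y_{eta n x}
   of the branch eta, at a level n fixed by the context. *)
Inductive key := KZ of var C | KY of tree_branch.

HB.instance Definition _ := gen_eqMixin key.
HB.instance Definition _ := gen_choiceMixin key.

Definition tag_key (k : key) : L :=
  match k with KZ t => tag t | KY e => tag e end.

Definition node (e : tree_branch) (i : nat) : var C :=
  Tagged (fun a => tree (C a)) (restr (tagged e) i).

Definition height (t : var C) : nat := size (val (tagged t)).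

Definition bit (e : tree_branch) (i : nat) : bool := val (tagged e) i.

Lemma height_node e i : height (node e i) = i.
Proof. by rewrite /height /= size_mkseq. Qed.

Lemma node_tag e e' i : node e i = node e' i -> tag e = tag e'.
Proof. by move/(congr1 tag). Qed.

(** Branches of different trees never share a node, as the trees are disjoint copies; in one tree
    two branches that differ at [j] have different nodes from height [j.+1] on. *)
Lemma node_separated e e' :
  exists n, forall i, (n <= i)%N -> node e i = node e' i -> e = e'.
Proof.
case: e e' => [a eta] [a' eta'].
have [aa|aa] := pselect (a = a'); last by exists 0%N => i _ /node_tag.
case: a' / aa eta' => eta'.
have [ee|ee] := pselect (eta = eta'); first by exists 0%N => i _ _; rewrite ee.
have [j ej] : exists j, val eta j != val eta' j.
  apply: contrapT => h; apply: ee; apply: val_inj; apply/funext => j.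
  by apply: contrapT => hj; apply: h; exists j; apply/eqP.
exists j.+1 => i ji /eqP; rewrite eq_Tagged /= => /eqP /(congr1 val) /=.
move/(congr1 (fun t => nth false t j)); rewrite !nth_mkseq // => h.
by case/eqP: ej.
Qed.

End FormalVariables.

Lemma eventually_all (T : eqType) (D : seq T) (H : T -> nat -> Prop) :
  (forall x, x \in D -> exists n, forall i, (n <= i)%N -> H x i) ->
  exists n, forall i, (n <= i)%N -> forall x, x \in D -> H x i.
Proof.
elim: D => [_|x D IH HD]; first by exists 0%N.
have [n nP] := HD x (mem_head _ _).
have [m mP] : exists n, forall i, (n <= i)%N -> forall x, x \in D -> H x i.
  by apply: IH => y yD; apply: HD; rewrite inE yD orbT.
exists (maxn n m) => i; rewrite geq_max => /andP[ni mi] y.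
by rewrite inE => /predU1P[->|]; [apply: nP|apply: mP].
Qed.

Lemma addr4K (U : zmodType) (u v w z : U) : u + v + w + z - u = v + (w + z).
Proof. by rewrite -!addrA addrC -!addrA addNr addr0. Qed.

(** The error of a retraction on one branch variable [y]: [r] is the expansion without the node, [a]
    the coefficient of the node and [c] its approximate inverse. *)
Lemma scaler_elim (R : comNzRingType) (U : lmodType R) (a c : R) (r y : U) :
  r + a *: (c *: (y - r)) - y = (c * a - 1) *: (y - r).
Proof. by rewrite scalerA scalerBl scale1r opprB mulrC addrAC addrC. Qed.

(** * Expansion to higher levels and its retractions *)

Section FormalModel.
Variables (F : idomainType) (s : nat -> F).
Variables (d : Order.disp_t) (L : orderType d) (C : L -> set nat).
Local Notation key := (key C).
Local Notation P := {malg F[{cmonom key}]}.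
Local Notation B := (base_alg F C).
Local Notation br := (tree_branch C).

Definition fvar (k : key) : P := << ucm k >>.

Definition lift_base : B -> P := malgev (@malgC {cmonom key} F) (fun t => fvar (KZ t)).
Lemma lift_baseD : {morph lift_base : p p' / p + p'}.
Proof. exact: (rmorphD (malgev _ _)). Qed.
Lemma lift_baseM : {morph lift_base : p p' / p * p'}.
Proof. exact: (rmorphM (malgev _ _)). Qed.

Lemma lift_baseX t : lift_base (zvar F t) = fvar (KZ t).
Proof. exact: malgevX. Qed.

Definition base_part : P -> B := malgev (@malgC {cmonom (var C)} F)
  (fun k => if k is KZ t then zvar F t else 0).
Lemma base_partD : {morph base_part : p p' / p + p'}.
Proof. exact: (rmorphD (malgev _ _)). Qed.
Lemma base_partM : {morph base_part : p p' / p * p'}.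
Proof. exact: (rmorphM (malgev _ _)). Qed.

Lemma base_partZ a p : base_part (a *: p) = a *: base_part p.
Proof. by rewrite [LHS]malgevZ mul_malgC. Qed.
Lemma lift_baseZ a b : lift_base (a *: b) = a *: lift_base b.
Proof. by rewrite [LHS]malgevZ mul_malgC. Qed.
Lemma base_part_sum (r : seq nat) (E : nat -> P) :
  base_part (\sum_(i <- r) E i) = \sum_(i <- r) base_part (E i).
Proof. exact: malgev_sum. Qed.

Lemma base_partK p : poly_in (fun k => if k is KZ _ then True else False) p ->
  lift_base (base_part p) = p.
Proof.
elim/poly_in_ind => [c|[t|//] _|p1 p2 h1 h2|p1 p2 h1 h2].
- by rewrite /base_part malgevC /lift_base malgevC.
- by rewrite /base_part malgevX lift_baseX.
- by rewrite base_partD lift_baseD h1 h2.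
- by rewrite base_partM lift_baseM h1 h2.
Qed.

Lemma lift_baseK (b : B) : base_part (lift_base b) = b.
Proof.
have := @poly_in_true _ _ b; elim/poly_in_ind => [c|t _|p1 p2 h1 h2|p1 p2 h1 h2].
- by rewrite /lift_base malgevC /base_part malgevC.
- by rewrite lift_baseX /base_part malgevX.
- by rewrite lift_baseD base_partD h1 h2.
- by rewrite lift_baseM base_partM h1 h2.
Qed.

Lemma poly_in_lift (G : key -> Prop) (b : B) :
  poly_in (fun t => G (KZ t)) b -> poly_in G (lift_base b).
Proof. by apply: poly_in_malgev => t Gt; apply: poly_inX. Qed.

Variable x : L -> B.

(* With [c = q_m/q_n] this expresses the variables of level n through those of
   level m; with [c = 0] it truncates the series at m. *)
Definition expand_branch (c : F) (n m : nat) (e : br) : P :=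
  \sum_(n <= i < m) qquot s n i *:
      (fvar (KZ (node e i)) + (bit e i)%:R *: lift_base (x (tag e)))
  + c *: fvar (KY e).

Definition expand (c : F) (n m : nat) : P -> P :=
  malgev (@malgC {cmonom key} F)
    (fun k => match k with KZ t => fvar (KZ t) | KY e => expand_branch c n m e end).
Lemma expandD c n m : {morph (expand c n m) : p p' / p + p'}.
Proof. exact: (rmorphD (malgev _ _)). Qed.
Lemma expandM c n m : {morph (expand c n m) : p p' / p * p'}.
Proof. exact: (rmorphM (malgev _ _)). Qed.

(** At such a level the expansion of a branch of [D] can be solved for its node of height [n]: this
    node is new, as everything else given lies strictly lower, and it determines the branch. *)
Definition good_level (D : seq key) (n : nat) :=
  [/\ forall t, KZ t \in D -> (height t < n)%N,
      forall e, KY e \in D -> poly_in (fun t => height t < n)%N (x (tag e))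
    & forall e e', KY e \in D -> KY e' \in D -> node e n = node e' n -> e = e'].

(** Tree variables are restricted by height and not by [D], since expansion brings in further
    nodes. *)
Definition level_key (D : seq key) (n : nat) (j : key) : Prop :=
  match j with KZ t => (height t < n)%N | KY _ => j \in D end.

Lemma level_keyP D n j : good_level D n -> j \in D -> level_key D n j.
Proof. by case: j => [t|e] // [+ _ _] => /[apply]. Qed.

Lemma poly_in_expand_level D c n m p : good_level D m ->
  poly_in (level_key D m) p -> poly_in (level_key D m) (expand c n m p).
Proof.
move=> gD; apply: poly_in_malgev => -[t|e] jD; first exact: poly_inX.
have [_ /(_ e jD) xe _] := gD.
apply: supp_inD; last first.
  by apply: supp_inZ; apply: poly_inX.
rewrite big_seq; apply: (big_ind (supp_in (mon_in (level_key D m)))) => [|p1 p2|i].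
- exact: supp_in0.
- exact: supp_inD.
rewrite mem_index_iota => /andP[_ im]; apply: supp_inZ; apply: supp_inD.
  by apply: poly_inX; rewrite /level_key height_node.
by apply: supp_inZ; apply: poly_in_lift; apply: poly_in_sub xe.
Qed.

(** Each condition concerns finitely many variables or pairs of branches and holds from some level
    on. *)
Lemma good_level_exists D :
  exists n, forall i, (n <= i)%N -> good_level D i.
Proof.
have bnd (r : seq (var C)) : exists n, forall t, t \in r -> (height t < n)%N.
  have [n nP] : exists n, forall i, (n <= i)%N -> forall t, t \in r -> (height t < i)%N.
    by apply: eventually_all => t _; exists (height t).+1.
  by exists n => t; apply: nP.
pose H (k : key) n : Prop := match k with
  | KZ t => (height t < n)%N
  | KY e => poly_in (fun t => height t < n)%N (x (tag e)) /\
            forall e', KY e' \in D -> node e n = node e' n -> e = e' end.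
have [n nP] : exists n, forall i, (n <= i)%N -> forall k, k \in D -> H k i.
  apply: eventually_all => -[t|e] kD /=; first by exists (height t).+1.
  have [r xr _] := poly_in_keys (x (tag e)); have [n1 n1P] := bnd r.
  have [n2 n2P] : exists n, forall i, (n <= i)%N -> forall k, k \in D ->
      if k is KY e' then node e i = node e' i -> e = e' else True.
    by apply: eventually_all => -[t|e'] _; [exists 0%N|apply: node_separated].
  exists (maxn n1 n2) => i; rewrite geq_max => /andP[i1 i2]; split.
    by apply: poly_in_sub xr => t /n1P ht; apply: leq_trans i1.
  by move=> e' e'D; apply: (n2P i i2 (KY e')).
exists n => i ni; split.
- by move=> t tD; apply: (nP i ni (KZ t)).
- by move=> e eD; case: (nP i ni (KY e) eD).
- by move=> e e' eD; case: (nP i ni (KY e) eD) => _; apply.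
Qed.

(* Solves the expansion of the branch [e] for its node of height [k]: [u] is meant
   to be an inverse of [qquot s n k], exact or modulo [s k]. *)
Definition retract_key (D : seq key) (c : F) (n m k : nat) (u : F) (j : key) : P :=
  match j with
  | KZ t =>
    if pselect (exists e, KY e \in D /\ t = node e k) is left h then
      let e := projT1 (cid h) in
      u *: (fvar (KY e) - (expand_branch c n m e - qquot s n k *: fvar (KZ (node e k))))
    else fvar (KZ t)
  | KY e => fvar (KY e)
  end.

Definition retract D c n m k u : P -> P :=
  malgev (@malgC {cmonom key} F) (retract_key D c n m k u).
Lemma retractD D c n m k u : {morph (retract D c n m k u) : p p' / p + p'}.
Proof. exact: (rmorphD (malgev _ _)). Qed.
Lemma retractM D c n m k u : {morph (retract D c n m k u) : p p' / p * p'}.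
Proof. exact: (rmorphM (malgev _ _)). Qed.

Lemma retractZ D c n m k u a p :
  retract D c n m k u (a *: p) = a *: retract D c n m k u p.
Proof. by rewrite -mul_malgC -[RHS]mul_malgC retractM [X in X * _]malgevC. Qed.

Section Retract.
Variables (D : seq key) (c : F) (n m k : nat) (u : F).
Let off_level (j : key) : Prop := if j is KZ t then height t != k else True.
Hypotheses (gD : good_level D k) (nk : (n <= k)%N) (km : (k < m)%N).

Lemma retract_Z t : height t != k -> retract D c n m k u (fvar (KZ t)) = fvar (KZ t).
Proof.
move=> tk; rewrite /retract malgevX /=; case: pselect => // h.
by have [e [_ te]] := h; case/eqP: tk; rewrite te height_node.
Qed.

Lemma retract_Y e : retract D c n m k u (fvar (KY e)) = fvar (KY e).
Proof. by rewrite /retract malgevX. Qed.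

Lemma retract_node e : KY e \in D ->
  retract D c n m k u (fvar (KZ (node e k))) =
  u *: (fvar (KY e) - (expand_branch c n m e - qquot s n k *: fvar (KZ (node e k)))).
Proof.
move=> eD; rewrite /retract malgevX /=; case: pselect => [h|[]]; last by exists e.
(* The branch chosen through this node can only be [e], because the level is good. *)
case: (cid h) => e' [e'D ee'] /=; have [_ _ inj] := gD.
by rewrite (inj _ _ eD e'D ee').
Qed.

Lemma retract_fix p :
  poly_in off_level p ->
  retract D c n m k u p = p.
Proof.
elim/poly_in_ind => [a|[t|e] h|p1 p2 h1 h2|p1 p2 h1 h2].
- exact: malgevC.
- exact: retract_Z.
- exact: retract_Y.
- by rewrite retractD h1 h2.
- by rewrite retractM h1 h2.
Qed.

(** Once the node of height [k] is removed, no variable of that height remains: the other nodes have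
    other heights and [x (tag e)] lies below [k]. *)
Lemma expand_rest_fix e : KY e \in D ->
  poly_in off_level
    (expand_branch c n m e - qquot s n k *: fvar (KZ (node e k))).
Proof.
move=> eD; rewrite /expand_branch (bigD1_seq k) ?iota_uniq //=; last first.
  by rewrite mem_index_iota nk.
rewrite scalerDr addr4K.
have px i : poly_in off_level
    (i *: lift_base (x (tag e))).
  apply: supp_inZ; apply: poly_in_lift; have [_ /(_ e eD) + _] := gD.
  by apply: poly_in_sub => t; rewrite ltn_neqAle => /andP[].
apply: supp_inD.
  by apply: supp_inZ; apply: px.
apply: supp_inD; last first.
  by apply: supp_inZ; apply: poly_inX.
apply: (big_ind (supp_in (mon_in off_level))) => [|p p'|i ik].
- exact: supp_in0.
- exact: supp_inD.
apply: supp_inZ.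
apply: supp_inD; last exact: px.
by apply: poly_inX; rewrite /off_level height_node.
Qed.

(** Substituting the solved node into the expansion of a branch gives the branch variable back, up
    to the error of [u] as an inverse of q_k/q_n. The error is 0 for [n = k] and [u = 1], and a
    multiple of [s k] for an inverse modulo [s k]. *)
Lemma retract_expand p : poly_in (level_key D k) p ->
  dcong (u * qquot s n k - 1) (retract D c n m k u (expand c n m p)) p.
Proof.
elim/poly_in_ind => [a|[t|e] jD|p1 p2 h1 h2|p1 p2 h1 h2].
- rewrite /expand malgevC /retract malgevC; exact: dcong_refl.
- rewrite /expand malgevX /= retract_Z; first exact: dcong_refl.
  by move: jD; rewrite /= ltn_neqAle => /andP[].
- rewrite /expand malgevX /=.
  rewrite -[X in retract _ _ _ _ _ _ X](subrK (qquot s n k *: fvar (KZ (node e k)))).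
  rewrite retractD (retract_fix (expand_rest_fix jD)) retractZ (retract_node jD).
  by eexists; apply: scaler_elim.
- rewrite expandD retractD; exact: dcongD.
- rewrite expandM retractM; exact: dcongM.
Qed.

End Retract.
End FormalModel.

(** * Polynomials over a set of stages *)

Section Tags.
Variables (F : idomainType) (s : nat -> F).
Variables (d : Order.disp_t) (L : orderType d) (C : L -> set nat).
Variables (V : forall a : L, set (branch (C a))) (x : L -> base_alg F C).
Local Notation key := (key C).
Local Notation P := {malg F[{cmonom key}]}.
Implicit Types (T : L -> Prop) (p : P).

Definition key_in T (k : key) : Prop :=
  match k with KZ t => T (tag t) | KY e => T (tag e) /\ V (tagged e) end.

Definition tag_closed T := forall a, T a -> poly_in (key_in T) (lift_base (x a)).

Lemma poly_in_expand_branch T c n m e : tag_closed T -> key_in T (KY e) ->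
  poly_in (key_in T) (expand_branch s x c n m e).
Proof.
move=> clT [Te Ve]; apply: supp_inD.
  apply: supp_in_sum => i; apply: supp_inZ; apply: supp_inD.
    exact: poly_inX.
  by apply: supp_inZ; apply: clT.
by apply: supp_inZ; apply: poly_inX.
Qed.

Lemma poly_in_expand T c n m p : tag_closed T ->
  poly_in (key_in T) p -> poly_in (key_in T) (expand s x c n m p).
Proof.
move=> clT; apply: poly_in_malgev => -[t|e] Tk; first exact: poly_inX.
exact: poly_in_expand_branch.
Qed.

(** A node is replaced using a branch through it, which has the same tag; membership of this branch
    in [V] comes from [D]. *)
Lemma poly_in_retract T D c n m k u p : tag_closed T ->
  (forall e, KY e \in D -> V (tagged e)) ->
  poly_in (key_in T) p -> poly_in (key_in T) (retract s x D c n m k u p).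
Proof.
move=> clT VD; apply: poly_in_malgev => -[t|e] Tk; last exact: poly_inX.
rewrite /=; case: pselect => h; last exact: poly_inX.
case: (cid h) => e [eD te] /=; have Te : key_in T (KY e).
  by split; [rewrite [tag e](_ : _ = tag t) // te|exact: VD].
apply: supp_inZ; apply: supp_inB; first exact: poly_inX.
apply: supp_inB; first exact: poly_in_expand_branch.
by apply: supp_inZ; apply: poly_inX; case: Te.
Qed.

End Tags.

(** * Evaluation of formal polynomials *)

Section EvaluationInCompletion.
Variables (F : idomainType) (s : nat -> F).
Hypothesis S_coprime : pairwise_coprime s.
Hypothesis S_nonzero : forall n, s n != 0.
Hypothesis S_sep : S_hausdorff s.
Variables (d : Order.disp_t) (L : orderType d) (C : L -> set nat).
Variable ds : (nat -> bhat s C) -> nat -> bhat s C.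
Hypothesis ds_sum : forall u, tail_series u (ds u).
Variable x : L -> base_alg F C.
Local Notation key := (key C).
Local Notation P := {malg F[{cmonom key}]}.
Local Notation B := (base_alg F C).
Local Notation bh := (bhat s C).

Definition bemb : B -> bh := @emb F s B.

Lemma bembD : {morph bemb : b b' / b + b'}.
Proof. exact: (rmorphD (@emb F s B)). Qed.
Lemma bembM : {morph bemb : b b' / b * b'}.
Proof. exact: (rmorphM (@emb F s B)). Qed.

Definition ykey (n : nat) (e : tree_branch C) : bh :=
  ybranch ds (tagged e) n (bemb (x (tag e))).

Definition ev (n : nat) : P -> bh := malgev (@scalar_emb F s B)
  (fun k => match k with KZ t => bemb (zvar F t) | KY e => ykey n e end).

Lemma evD n : {morph ev n : p p' / p + p'}.
Proof. exact: (rmorphD (malgev _ _)). Qed.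
Lemma evB n : {morph ev n : p p' / p - p'}.
Proof. exact: (rmorphB (malgev _ _)). Qed.
Lemma evM n : {morph ev n : p p' / p * p'}.
Proof. exact: (rmorphM (malgev _ _)). Qed.
Lemma ev0 n : ev n 0 = 0.
Proof. exact: (rmorph0 (malgev _ _)). Qed.
Lemma ev1 n : ev n 1 = 1.
Proof. exact: (rmorph1 (malgev _ _)). Qed.
Lemma ev_sum n (r : seq nat) (E : nat -> P) :
  ev n (\sum_(i <- r) E i) = \sum_(i <- r) ev n (E i).
Proof. exact: malgev_sum. Qed.
Lemma evC n c : ev n c%:MP = c *: (1 : bh).
Proof. exact: malgevC. Qed.
Lemma evZ n c p : ev n (c *: p) = c *: ev n p.
Proof. by rewrite [RHS]cscale_mul1; apply: malgevZ. Qed.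
Lemma evZvar n t : ev n (fvar F (KZ t)) = bemb (zvar F t).
Proof. exact: malgevX. Qed.
Lemma evYvar n e : ev n (fvar F (KY e)) = ykey n e.
Proof. exact: malgevX. Qed.

Lemma ev_lift n (b : B) : ev n (lift_base b) = bemb b.
Proof.
have := @poly_in_true _ _ b; elim/poly_in_ind => [c|t _|p1 p2 h1 h2|p1 p2 h1 h2].
- rewrite /lift_base malgevC evC.
  have -> : (c%:MP : B) = c *: (1 : B) by rewrite -mul_malgC mulr1.
  by rewrite /bemb embZ /scalar_emb -cscale_mul1 rmorph1.
- by rewrite lift_baseX evZvar.
- by rewrite lift_baseD evD h1 h2 bembD.
- by rewrite lift_baseM evM h1 h2 bembM.
Qed.

Lemma ykey_expand n m e : (n <= m)%N ->
  ykey n e = ev m (expand_branch s x (qquot s n m) n m e).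
Proof.
move=> nm; rewrite /expand_branch evD evZ evYvar ev_sum.
have tl := tail_series_lincomb (bemb (x (tag e)))
  (ds_sum (fun i => bemb (zvar F (node e i)))) (ds_sum (fun i => (bit e i)%:R)).
have -> : ykey n e = ds (fun i => bemb (zvar F (node e i))) n
    + bemb (x (tag e)) * ds (fun i => (bit e i)%:R) n by [].
rewrite [LHS](tl n m nm).
apply: (f_equal2 +%R); last by [].
apply: eq_bigr => i _.
rewrite evZ evD evZ evZvar ev_lift mulrC; apply: (f_equal ( *:%R _)).
apply: (f_equal2 +%R); first by [].
by case: (bit e i); rewrite ?mul1r ?mul0r ?scale1r ?scale0r.
Qed.

Lemma ev_expand n m p : (n <= m)%N ->
  ev m (expand s x (qquot s n m) n m p) = ev n p.
Proof.
move=> nm; have := @poly_in_true _ _ p.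
elim/poly_in_ind => [c|[t|e] _|p1 p2 h1 h2|p1 p2 h1 h2].
- by rewrite /expand malgevC !evC.
- by rewrite /expand malgevX !evZvar.
- by rewrite /expand malgevX /= evYvar -ykey_expand.
- by rewrite expandD !evD h1 h2.
- by rewrite expandM !evM h1 h2.
Qed.

(** For [n <= k] the series beyond height [k] is divisible by [s k], so this factor of the value is
    the truncation, whatever tails [ds] chooses. *)
Lemma at_factor_ev n k p : (n <= k)%N ->
  at_factor k (ev n p) (base_part (expand s x 0 n k.+1 p)).
Proof.
move=> nk; have := @poly_in_true _ _ p.
elim/poly_in_ind => [c|[t|e] _|p1 p2 h1 h2|p1 p2 h1 h2].
- rewrite evC /expand malgevC /base_part malgevC.
  have cE : (c%:MP : B) = c *: (1 : B) by rewrite -mul_malgC mulr1.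
  rewrite -[X in at_factor _ _ X]/(c%:MP : B) cE.
  by apply: at_factorZ; apply: at_factor_emb.
- rewrite evZvar /expand malgevX /base_part malgevX; exact: at_factor_emb.
- rewrite evYvar /expand malgevX /= /expand_branch scale0r addr0.
  rewrite base_part_sum.
  have E i : base_part
        (qquot s n i *: (fvar F (KZ (node e i)) + (bit e i)%:R *: lift_base (x (tag e))))
      = qquot s n i *: zvar F (node e i) + x (tag e) * (qquot s n i *: (bit e i)%:R).
    rewrite base_partZ base_partD base_partZ lift_baseK scalerDr.
    apply: (f_equal2 +%R); first by rewrite /base_part malgevX.
    rewrite -scalerAr; apply: (f_equal ( *:%R _)).
    by case: (bit e i); rewrite ?scale1r ?scale0r ?mulr1 ?mulr0.
  rewrite (eq_bigr _ (fun i _ => E i)) big_split /= -mulr_sumr.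
  apply: at_factorD.
    apply: (tail_series_factor (ds_sum _) nk) => i; exact: at_factor_emb.
  apply: at_factorM; first exact: at_factor_emb.
  apply: (tail_series_factor (ds_sum _) nk) => i.
  rewrite -[val (tagged e) i]/(bit e i).
  by case: (bit e i); apply: at_factor_emb.
- rewrite evD expandD base_partD; exact: at_factorD.
- rewrite evM expandM base_partM; exact: at_factorM.
Qed.

Lemma expand0_base n m p : lift_base (base_part (expand s x 0 n m p)) = expand s x 0 n m p.
Proof.
apply: base_partK; have := @poly_in_true _ _ p.
apply: poly_in_malgev => -[t|e] _; first exact: poly_inX.
rewrite /expand_branch scale0r addr0; apply: supp_in_sum => i.
apply: supp_inZ; apply: supp_inD; first exact: poly_inX.
by apply: supp_inZ; apply: poly_in_lift.
Qed.

(** In a factor of large index [k] both values are truncations without branch variables. There the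
    nodes of the branches in [D] are distinct and new, and [u] inverts q_k/q_n modulo [s k]; so the
    retraction recovers [p] from its truncation, hence from that of [p']. *)
Lemma ev_eq_dcong n m p p' (D : seq key) : poly_in (fun j => j \in D) p ->
  ev n p = ev m p' -> exists k0, forall k, (k0 <= k)%N -> exists u,
    dcong (s k) p (retract s x D 0 n k.+1 k u (expand s x 0 m k.+1 p')).
Proof.
move=> pD pp'; have [n0 n0P] := good_level_exists x D.
exists (maxn (maxn n m) n0) => k; rewrite !geq_max -andbA => /and3P[nk mk n0k].
have gD := n0P k n0k.
have [u [v uv]] := qquot_inv S_coprime nk; exists u.
have fp := at_factor_ev p nk; have fp' := at_factor_ev p' mk.
move: fp; rewrite pp' => fp; have [y yE] := dcong_trans (dcong_sym fp) fp'.
have [z zE] := @retract_expand F s d L C x D 0 n k.+1 k u gD nk (ltnSn k) p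
  (poly_in_sub (fun j => level_keyP gD) pD).
(* Truncations contain no branch variables, so their congruence in the base algebra lifts to the
   formal polynomials. *)
have TE : expand s x 0 n k.+1 p = s k *: lift_base y + expand s x 0 m k.+1 p'.
  rewrite -[LHS]expand0_base -[X in _ + X]expand0_base.
  rewrite -[base_part (expand s x 0 n k.+1 p)](subrK (base_part (expand s x 0 m k.+1 p'))).
  by rewrite lift_baseD yE lift_baseZ.
move: zE; rewrite TE retractD retractZ uv.
set a := retract _ _ _ _ _ _ _ _ _; set a' := retract _ _ _ _ _ _ _ _ _ => zE.
exists (a - v *: z); rewrite scalerBr scalerA -zE opprB addrCA.
by rewrite opprD [X in _ = _ + X]addrA subrr add0r.
Qed.

Lemma mcoeff_eq0_of_dcong (p : P) mm k0 :
  (forall k, (k0 <= k)%N -> exists2 p', dcong (s k) p p' & p'@_mm = 0) -> p@_mm = 0.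
Proof.
move=> h; apply: (eq0_of_divisible S_coprime (n := k0)) => // k nk.
have [p' [z pz] p'0] := h k nk; exists (z@_mm).
by rewrite -mcoeffZ -pz mcoeffB p'0 subr0.
Qed.

(** Comparison with the polynomial 0: every coefficient of [p] is divisible by [s k] for all large
    [k]. *)
Lemma ev_inj0 n p : ev n p = 0 -> p = 0.
Proof.
move=> p0; have [D pD _] := poly_in_keys p.
have [k0 k0P] := @ev_eq_dcong n n p 0 D pD (etrans p0 (esym (ev0 n))).
apply/malgP => mm; rewrite mcoeff0; apply: (mcoeff_eq0_of_dcong (k0 := k0)) => k k0k.
have [u h] := k0P k k0k; exists 0; last by rewrite mcoeff0.
move: h; rewrite [expand _ _ _ _ _ 0](_ : _ = 0); last exact: (rmorph0 (malgev _ _)).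
by rewrite [retract _ _ _ _ _ _ _ _ 0](_ : _ = 0) //; exact: (rmorph0 (malgev _ _)).
Qed.

(* Keys are taken from V so that the retractions preserve [key_in V]. *)
Lemma ev_poly_in (V : forall a, set (branch (C a))) T T' n m p p' :
  tag_closed V x T -> poly_in (key_in V T') p -> poly_in (key_in V T) p' ->
  ev n p = ev m p' -> poly_in (key_in V T) p.
Proof.
move=> clT pT' p'T pp'; have [D pD DT] := poly_in_keys p.
have [k0 k0P] := ev_eq_dcong pD pp'.
apply/supp_inE => mm nT; apply: (mcoeff_eq0_of_dcong (k0 := k0)) => k k0k.
have [u h] := k0P k k0k; eexists; first exact: h.
suff /supp_inE : poly_in (key_in V T)
    (retract s x D 0 n k.+1 k u (expand s x 0 m k.+1 p')) by apply.
apply: poly_in_retract => //; last exact: poly_in_expand.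
by move=> e eD; have := DT _ pT' _ eD; case.
Qed.

Lemma ev_max n m p p' : exists k q q',
  [/\ ev n p = ev k q, ev m p' = ev k q' &
      forall (V : forall a, set (branch (C a))) T, tag_closed V x T ->
        (poly_in (key_in V T) p -> poly_in (key_in V T) q) /\
        (poly_in (key_in V T) p' -> poly_in (key_in V T) q')].
Proof.
exists (maxn n m), (expand s x (qquot s n (maxn n m)) n (maxn n m) p),
  (expand s x (qquot s m (maxn n m)) m (maxn n m) p').
split; rewrite ?ev_expand ?leq_maxl ?leq_maxr // => V T clT.
by split; apply: poly_in_expand.
Qed.

End EvaluationInCompletion.

(** * The stages of the construction *)

Section SubalgebraOfModel.
Variables (F : idomainType) (s : nat -> F).
Hypothesis S_coprime : pairwise_coprime s.
Hypothesis S_nonzero : forall n, s n != 0.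
Hypothesis S_sep : S_hausdorff s.
Variables (d : Order.disp_t) (L : orderType d) (C : L -> set nat).
Variable V : forall a : L, set (branch (C a)).
Variable ds : (nat -> bhat s C) -> nat -> bhat s C.
Hypothesis ds_sum : forall u, tail_series u (ds u).
Variable b : L -> base_alg F C.
Variable L_wf : well_founded (fun c a : L => (c < a)%O).
Local Notation Ra := (Ralpha ds V b L_wf).
Local Notation bh := (bhat s C).
Local Notation emb := (bemb s).

Definition sel (a : L) : base_alg F C :=
  if `[< Ra a (Defs.emb s (b a)) /\ exists2 c, is_norm (b a) c & (c <= a)%O >]
  then b a else 0.

Lemma xselE a : xsel b a (Ra a) = emb (sel a).
Proof. by rewrite /xsel /sel; case: asboolP. Qed.

Definition model (T : L -> Prop) : set bh :=
  [set u | exists n p, poly_in (key_in V T) p /\ u = ev ds sel n p].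

Lemma model_mono (T T' : L -> Prop) : (forall a, T a -> T' a) -> model T `<=` model T'.
Proof.
move=> TT u [n [p [pT ->]]]; exists n, p; split=> //.
by apply: poly_in_sub pT => -[t|e] /=; [apply: TT|move=> [/TT]].
Qed.

Lemma model_subalgebra T : tag_closed V sel T -> subalgebra (model T).
Proof.
move=> clT.
have common u v : model T u -> model T v -> exists n p p',
    [/\ poly_in (key_in V T) p, poly_in (key_in V T) p', u = ev ds sel n p
      & v = ev ds sel n p'].
  move=> [n [p [pT ->]]] [m [p' [pT' ->]]].
  have [k [r [r' [-> -> h]]]] := ev_max ds_sum sel n m p p'.
  by have [h1 h2] := h V T clT; exists k, r, r'; split=> //; [apply: h1|apply: h2].
split; split.
- by rewrite inE; exists 0%N, 0; rewrite ev0; split=> //; apply: supp_in0.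
- move=> c u v; rewrite !inE => mu mv; have [n [p [p' [pT pT' -> ->]]]] := common u v mu mv.
  exists n, (c *: p + p'); rewrite evD evZ; split=> //.
  by apply: supp_inD => //; apply: supp_inZ.
- rewrite inE; exists 0%N, 1; rewrite ev1; split=> //; exact: poly_inC.
- move=> u v; rewrite !inE => mu mv; have [n [p [p' [pT pT' -> ->]]]] := common u v mu mv.
  by exists n, (p * p'); rewrite evM; split=> //; apply: poly_inM.
Qed.

Lemma subalgebraP (N : set bh) : subalgebra N ->
  [/\ submodule N, forall c : F, N (c *: (1 : bh)), forall u v, N u -> N v -> N (u + v)
    & forall u v, N u -> N v -> N (u * v)].
Proof.
move=> [sN [N1 NM]]; have N1' : N 1 by move: N1; rewrite inE.
split=> // [c|u v|u v].
- exact: submodZ.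
- exact: submodD.
- by have := NM u v; rewrite !inE; apply.
Qed.

Lemma alg_span_subalgebra (X : set bh) : subalgebra (alg_span X).
Proof.
split; first exact: alg_span_submod.
split; first by rewrite inE => N [[_ [N1 _]] _]; move: N1; rewrite inE.
move=> u v; rewrite !inE => Au Av N NX; have [[_ [_ NM]] _] := NX.
by have := NM u v; rewrite !inE; apply; [apply: Au|apply: Av].
Qed.

Lemma model_in (N : set bh) T : subalgebra N ->
  (forall t, T (tag t) -> N (emb (zvar F t))) ->
  (forall e n, T (tag e) -> V (tagged e) -> N (ykey ds sel n e)) -> model T `<=` N.
Proof.
move=> /subalgebraP [_ NC ND NM] NZ NY u [n [p [pT ->]]].
elim/poly_in_ind: pT => [c|[t|e] /= kT|p1 p2 h1 h2|p1 p2 h1 h2].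
- by rewrite evC.
- by rewrite evZvar; apply: NZ.
- by rewrite evYvar; apply: NY; case: kT.
- by rewrite evD; apply: ND.
- by rewrite evM; apply: NM.
Qed.

(** The least index is left out because the step from R_0 to R_1 adjoins no variables. *)
Definition pos_below (a c : L) : Prop := ~ ozero c /\ (c < a)%O.
Definition pos (c : L) : Prop := ~ ozero c.

(** A selected [b a] lies in [Ra a], so it is the value of a polynomial with indices below [a]; by
    injectivity of evaluation that polynomial is the lift of [b a]. *)
Lemma sel_closed a : Ra a = model (pos_below a) ->
  poly_in (key_in V (pos_below a)) (lift_base (sel a)).
Proof.
move=> RaE; rewrite /sel; case: asboolP => [[+ _]|_]; last first.
  rewrite [lift_base _](_ : _ = 0); last exact: (rmorph0 (malgev _ _)).
  exact: supp_in0.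
rewrite RaE => -[n [p [pT bE]]].
suff -> : lift_base (b a) = p by [].
apply/eqP; rewrite -subr_eq0; apply/eqP.
apply: (@ev_inj0 _ _ S_coprime S_nonzero S_sep _ _ _ _ ds_sum sel n).
by rewrite evB -bE ev_lift [X in X - _](_ : _ = Defs.emb s (b a)) // subrr.
Qed.

(** A polynomial has finitely many variables, hence lives over an earlier stage. [U] is meant to be
    the set of predecessors of a limit, or of all indices. *)
Lemma keys_bounded (U : L -> Prop) (p : {malg F[{cmonom (key C)}]}) :
  (exists c, U c) -> (forall c, U c -> exists2 e, (c < e)%O & U e) ->
  poly_in (key_in V (fun c => pos c /\ U c)) p ->
  exists c, [/\ U c, ~ ozero c & poly_in (key_in V (pos_below c)) p].
Proof.
move=> [c0 Uc0] Ustep pT; have [D pD DT] := poly_in_keys p.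
have {}DT := DT _ pT.
have [c [Uc c1 cD]] : exists c, [/\ U c, ~ ozero c & forall k, k \in D -> (tag_key k < c)%O].
  elim: D DT {pD} => [_|k D IH DT].
    have [e ce Ue] := Ustep c0 Uc0; exists e; split=> //.
    by move=> /(_ c0); rewrite leNgt ce.
  have [c [Uc c1 cD]] : exists c, [/\ U c, ~ ozero c & forall k, k \in D -> (tag_key k < c)%O].
    by apply: IH => j jD; apply: DT; rewrite inE jD orbT.
  have [kz Uk] : pos (tag_key k) /\ U (tag_key k).
    by have := DT k (mem_head _ _); case: (k) => [t|e] //= [].
  have [e ke Ue] := Ustep _ Uk.
  case: (leP c e) => ce.
    exists e; split=> // [e0|j]; first by have := e0 (tag_key k); rewrite leNgt ke.
    by rewrite inE => /predU1P[->//|/cD jc]; apply: lt_le_trans ce.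
  exists c; split=> // j; rewrite inE => /predU1P[->|/cD //].
  exact: lt_trans ce.
exists c; split=> // m mp k mk; have kD := pD m mp k mk.
have := pT m mp k mk; have := cD k kD.
by case: (k) => [t|e] /= ? => [[? _]|[[? _] ?]]; do ?split.
Qed.

(** Transfinite induction along the clauses: limits are unions, no positive index lies below the
    first successor, and a later successor adds the variables of one tag. *)
Lemma Ralpha_model a : ~ ozero a -> Ra a = model (pos_below a).
Proof.
elim/(well_founded_ind L_wf): a => a IH a0.
(* The elements selected below [a] are controlled by the induction hypothesis at their own
   indices. *)
have clT : tag_closed V sel (pos_below a).
  move=> c [c0 ca]; apply: poly_in_sub (sel_closed (IH c ca c0)).
  have sub e : pos_below c e -> pos_below a e by move=> [? ec]; split=> //; apply: lt_trans ca.
  by move=> [t|e] /=; [apply: sub|move=> [/sub]].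
have sM := model_subalgebra clT.
have [[c ca]|al] := pselect (exists c, osucc c a); last first.
  have la : olimit a by split=> // c ca; apply: al; exists c.
  rewrite Ralpha_limit //; apply/seteqP; split=> [u [c /= ca]|u [n [p [pT ->]]]].
    have [c0|c0] := pselect (ozero c).
      rewrite Ralpha0 // => ->; have [sm _ _ _] := subalgebraP sM; exact: submod0.
    rewrite IH //; apply: model_mono => e [e0 ec]; split=> //; exact: lt_trans ca.
  have [|c ca| |c [ca c0 pc]] := @keys_bounded (fun c => (c < a)%O) p.
  - by apply: contrapT => h; apply: a0 => c; rewrite leNgt; apply/negP => ca;
      apply: h; exists c.
  - apply: contrapT => h; apply: al; exists c; split=> // e ce.
    by rewrite leNgt; apply/negP => ea; apply: h; exists e.
  - exact: pT.
  by exists c => //; rewrite IH //; exists n, p.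
have lt_ca : (c < a)%O by case: ca.
have le_c e : (e < a)%O -> (e <= c)%O.
  by move=> ea; rewrite leNgt; apply/negP => /(proj2 ca); rewrite leNgt ea.
have [c0|c0] := pselect (ozero c).
  rewrite (Ralpha1 _ _ _ _ c0 ca); apply/seteqP; split=> [u [r _ <-]|].
    by have [_ MC _ _] := subalgebraP sM.
  have none e : ~ pos_below a e.
    by move=> [e0 /le_c ec]; apply: e0 => f; apply: le_trans ec (c0 f).
  apply: model_in => [|t /none //|e n /none //].
  split; split.
  - by rewrite inE; exists 0 => //; rewrite scale0r.
  - move=> r u v; rewrite !inE => -[y _ <-] [z _ <-]; exists (r * y + z) => //.
    by rewrite scalerDl scalerA.
  - by rewrite inE; exists 1 => //; rewrite scale1r.
  - move=> u v; rewrite !inE => -[y _ <-] [z _ <-]; exists (y * z) => //.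
    exact: ((scalar_emb_monoid s (base_alg F C)).2 y z).
rewrite (RalphaS _ _ _ _ c0 ca) /adjoin xselE; apply/seteqP; split.
  apply: (@smallest_sub _ (@subalgebra _ _ _)) => // u.
  case=> [[|[eta [n [Veta ->]]]]|[t [tc ->]]].
  - rewrite IH // => mu; apply: model_mono mu => e [e0 ec].
    by split=> //; apply: lt_trans lt_ca.
  - exists n, (fvar F (KY (existT _ c eta))); rewrite evYvar; split=> //.
    by apply: poly_inX.
  - exists 0%N, (fvar F (KZ t)); rewrite evZvar; split=> //.
    by apply: poly_inX; rewrite /= tc.
have gen u : (Ra c `|` [set y | exists (eta : branch (C c)) n,
        V eta /\ y = ybranch ds eta n (emb (sel c))] `|`
      [set z | exists t : var C, tag t = c /\ z = Defs.emb s (zvar F t)]) u ->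
    alg_span (Ra c `|` [set y | exists (eta : branch (C c)) n,
        V eta /\ y = ybranch ds eta n (emb (sel c))] `|`
      [set z | exists t : var C, tag t = c /\ z = Defs.emb s (zvar F t)]) u.
  by move=> Xu N [_]; apply.
have below e : pos_below a e -> e = c \/ pos_below c e.
  by move=> [e0 /le_c]; rewrite le_eqVlt => /predU1P[->|ec]; [left|right].
apply: model_in => [|t /below [tc|tc]|[e eta] n /below [/= ec|ec] Ve].
- exact: alg_span_subalgebra.
- by apply: gen; right; exists t.
- apply: gen; left; left; rewrite IH //; exists 0%N, (fvar F (KZ t)).
  by rewrite evZvar; split=> //; apply: poly_inX.
- by apply: gen; left; right; subst e; exists eta, n.
- apply: gen; left; left; rewrite IH //; exists n, (fvar F (KY (existT _ e eta))).
  by rewrite evYvar; split=> //; apply: poly_inX.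
Qed.

Lemma sel_pos_closed : tag_closed V sel pos.
Proof.
move=> c c0; apply: poly_in_sub (sel_closed (Ralpha_model c0)).
by move=> [t|e] /= => [[]|[[]]].
Qed.

Lemma sel_below_closed a : tag_closed V sel (pos_below a).
Proof.
move=> c [c0 ca]; apply: poly_in_sub (sel_closed (Ralpha_model c0)).
have sub e : pos_below c e -> pos_below a e by move=> [? ec]; split=> //; apply: lt_trans ca.
by move=> [t|e] /=; [apply: sub|move=> [/sub]].
Qed.

Lemma Rtop_model : (exists a : L, True) -> (forall a : L, exists e, (a < e)%O) ->
  Rtop ds V b L_wf = model pos.
Proof.
move=> [a0 _] unb; apply/seteqP; split=> [u [a _]|u [n [p [pT ->]]]].
  have [a00|a1] := pselect (ozero a).
    rewrite Ralpha0 // => ->.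
    have [sm _ _ _] := subalgebraP (model_subalgebra sel_pos_closed); exact: submod0.
  by rewrite Ralpha_model //; apply: model_mono => e [].
have [|c _| |c [_ c0 pc]] := @keys_bounded (fun c => True) p.
- by exists a0.
- by have [e ce] := unb c; exists e.
- by apply: poly_in_sub pT => -[t|e] //= [].
by exists c => //; rewrite Ralpha_model //; exists n, p.
Qed.

End SubalgebraOfModel.

Lemma opprDr_swap (U : zmodType) (u v w : U) : u - (v + w) = u - w - v.
Proof. by rewrite opprD addrA addrAC. Qed.

(** * Freeness of the quotients *)

Section FreeQuotients.
Variables (F : idomainType) (s : nat -> F).
Hypothesis F_pid : principal_ideal_domain F.
Variables (d : Order.disp_t) (L : orderType d) (C : L -> set nat).
Variable V : forall a : L, set (branch (C a)).
Variable ds : (nat -> bhat s C) -> nat -> bhat s C.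
Hypothesis ds_sum : forall u, tail_series u (ds u).
Variable x : L -> base_alg F C.
Local Notation bh := (bhat s C).
Local Notation key := (key C).
Local Notation P := {malg F[{cmonom key}]}.
Local Notation evx := (ev ds x).

Variable T : L -> Prop.
Hypothesis clT : tag_closed V x T.
(** Both freeness claims are instances: [f] is the identity or the quotient map modulo R_alpha, and
    [Q] describes the monomials of the polynomials that [f] kills. *)
Variables (M : lmodType F) (f : bh -> M).
Hypothesis f_lin : forall (c : F) u v, f (c *: u + v) = c *: f u + f v.
Variable Q : {cmonom key} -> Prop.
Hypothesis f_ker : forall n p, poly_in (key_in V T) p ->
  (f (evx n p) = 0 <-> supp_in Q p).
Hypothesis Q_expand : forall c n m p, supp_in Q p -> supp_in Q (expand s x c n m p).
Hypothesis Q_retract : forall D c n m k u p, (forall e, KY e \in D -> V (tagged e)) ->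
  supp_in Q p -> supp_in Q (retract s x D c n m k u p).

Let G := poly_in (F := F) (key_in V T).
Let N : set M := [set w | exists n p, G p /\ w = f (evx n p)].

Let linG c p p' : G p -> G p' -> G (c *: p + p').
Proof. by move=> Gp Gp'; apply: supp_inD => //; apply: supp_inZ. Qed.

Let f0 : f 0 = 0.
Proof.
have := f_lin 1 0 0; rewrite !scale1r addr0 => /eqP.
by rewrite -subr_eq0 opprD addrA subrr add0r oppr_eq0 => /eqP.
Qed.

Let f_ev_lin n c p p' : f (evx n (c *: p + p')) = c *: f (evx n p) + f (evx n p').
Proof. by rewrite evD evZ f_lin. Qed.

Let f_evB n p p' : f (evx n (p - p')) = f (evx n p) - f (evx n p').
Proof.
have -> : p - p' = (-1) *: p' + p by rewrite scaleN1r addrC.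
by rewrite f_ev_lin scaleN1r addrC.
Qed.

Let level_up n m p : (n <= m)%N -> G p -> exists2 p', G p' & f (evx n p) = f (evx m p').
Proof.
move=> nm Gp; exists (expand s x (qquot s n m) n m p); last by rewrite ev_expand.
exact: poly_in_expand.
Qed.

Lemma image_submod : submodule N.
Proof.
apply/submodP; split; first by exists 0%N, 0; rewrite ev0 f0; split=> //; apply: supp_in0.
move=> c _ _ [n [p [Gp ->]]] [m [p' [Gp' ->]]].
have [r Gr ->] := level_up (leq_maxl n m) Gp.
have [r' Gr' ->] := level_up (leq_maxr n m) Gp'.
by exists (maxn n m), (c *: r + r'); rewrite f_ev_lin; split=> //; apply: linG.
Qed.

(** The polynomials are first raised to a common level, which fixes [D], and then to a level that is
    good for [D]. *)
Lemma finite_level (a : nat -> M) n : range a `<=` N ->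
  exists k D, [/\ good_level x D k, forall e, KY e \in D -> V (tagged e) &
    forall j, (j < n)%N -> exists2 g, G g /\ poly_in (level_key D k) g & a j = f (evx k g)].
Proof.
move=> aN.
have [m [D [DV aD]]] : exists m (D : seq key), (forall e, KY e \in D -> V (tagged e)) /\
    forall j, (j < n)%N -> exists2 g, G g /\ poly_in (fun i => i \in D) g & a j = f (evx m g).
  elim: n => [|n [m [D [DV aD]]]]; first by exists 0%N, [::].
  have [m' [p [Gp ap]]] : N (a n) by apply: aN; exists n.
  have up r j g : (r <= maxn m m')%N -> G g -> a j = f (evx r g) ->
      exists D' : seq key, (forall e, KY e \in D' -> V (tagged e)) /\
      exists2 g, G g /\ poly_in (fun i => i \in D') g & a j = f (evx (maxn m m') g).
    move=> rm Gg ->; have [h Gh ->] := level_up rm Gg.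
    have [D' hD' D'T] := poly_in_keys h; exists D'; split; last by exists h.
    by move=> e /(D'T _ Gh) [].
  have /choice [E EP] : forall j, exists E : seq key, (j < n.+1)%N ->
      (forall e, KY e \in E -> V (tagged e)) /\
      exists2 g, G g /\ poly_in (fun i => i \in E) g & a j = f (evx (maxn m m') g).
    move=> j; case: (ltnP j n.+1) => jn; last by exists [::].
    move: jn; rewrite ltnS leq_eqVlt => /predU1P[->|jn].
      by have [D' h] := up m' n p (leq_maxr _ _) Gp ap; exists D'.
    have [g [Gg _] ag] := aD j jn.
    by have [D' h] := up m j g (leq_maxl _ _) Gg ag; exists D'.
  exists (maxn m m'), (flatten [seq E j | j <- iota 0 n.+1]); split=> [e|j jn].
    move=> /flattenP [r /mapP [j]]; rewrite mem_iota => /andP[_ jn] -> eE.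
    by have [h _] := EP j jn; apply: h.
  have [_ [g [Gg gE] ag]] := EP j jn; exists g => //; split=> //.
  apply: poly_in_sub gE => i iE; apply/flattenP; exists (E j) => //.
  by apply/mapP; exists j => //; rewrite mem_iota.
have [k0 k0P] := good_level_exists x D.
exists (maxn m k0), D; have gD := k0P _ (leq_maxr m k0); split=> // j jn.
have [g [Gg gD'] ->] := aD j jn.
exists (expand s x (qquot s m (maxn m k0)) m (maxn m k0) g); last first.
  by rewrite ev_expand // leq_maxl.
split; first exact: poly_in_expand.
(* The last expansion leaves [D] but not [level_key D]. *)
apply: poly_in_expand_level => //.
by apply: poly_in_sub gD' => i; apply: (level_keyP gD).
Qed.

Let Q_cancel (c : F) (p : P) : c != 0 -> supp_in Q (c *: p) -> supp_in Q p.
Proof.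
move=> c0 /supp_inE h; apply/supp_inE => mm nQ; have := h mm nQ.
by rewrite mcoeffZ => /eqP; rewrite mulf_eq0 (negbTE c0) => /eqP.
Qed.

(* The elements with a multiple in the span of finitely many elements of level k
   are again of level k: the retraction from a higher level brings them back. *)
Lemma closure_at_level (a : nat -> M) n : range a `<=` N ->
  exists k, forall w, head_closure a n w -> exists2 p, G p & w = f (evx k p).
Proof.
move=> aN; have [k [D [gD DV aD]]] := finite_level n aN; exists k.
pose H := [set w | exists2 g, G g /\ poly_in (level_key D k) g & w = f (evx k g)].
have sH : submodule H.
  apply/submodP; split.
    by exists 0; rewrite ?ev0 ?f0 //; split; apply: supp_in0.
  move=> c _ _ [g [Gg gk] ->] [h [Gh hk] ->]; exists (c *: g + h); last by rewrite f_ev_lin.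
  by split; [apply: linG|apply: supp_inD => //; apply: supp_inZ].
move=> w [wa [c c0 wc]].
have [g [Gg gk] wg] : H (c *: w).
  by move: wc; apply: lspan_sub => // _ [j jn <-]; apply: aD.
have [m0 [p0 [Gp0 wp0]]]  := lspan_sub image_submod aN wa.
(* The level must exceed [k], so that the expansion contains the nodes of height [k]. *)
have [p Gp] := level_up (leq_maxl m0 k.+1) Gp0; rewrite -wp0 => {p0 Gp0}wp0.
move: (maxn m0 k.+1) (leq_maxr m0 k.+1) wp0 => m km wp {m0}.
pose ex := expand s x (qquot s k m) k m; pose re := retract s x D (qquot s k m) k m k 1.
have Gex r : G r -> G (ex r) by apply: poly_in_expand.
have Gre r : G r -> G (re r) by apply: poly_in_retract.
have exZ r e : ex (e *: r) = e *: ex r by rewrite [LHS]malgevZ mul_malgC.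
have reB r r' : re (r - r') = re r - re r' by apply: (rmorphB (malgev _ _)).
(* From level [k] the node of height [k] has coefficient 1, so the retraction is exact. *)
have reK : re (ex g) = g.
  have q1 : qquot s k k = 1 by rewrite /qquot big_geq.
  have := @retract_expand F s d L C x D (qquot s k m) k m k 1 gD (leqnn k) km g gk.
  rewrite -/(ex g) -/(re (ex g)) q1 mulr1 subrr => -[z /eqP].
  by rewrite scale0r subr_eq0 => /eqP.
have Qr : supp_in Q (c *: p - ex g).
  apply/(f_ker m); first by apply: supp_inB; [apply: supp_inZ|apply: Gex].
  rewrite f_evB (ev_expand ds_sum x g (ltnW km)).
  by rewrite -wg wp evZ -[c *: evx m p]addr0 f_lin f0 addr0 subrr.
exists (re p); first by apply: Gre.
rewrite wp -(ev_expand ds_sum x (re p) (ltnW km)) -/(ex (re p)).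
apply/eqP; rewrite -subr_eq0 -f_evB; apply/eqP; apply/(f_ker m).
  by apply: supp_inB; last apply/Gex/Gre.
(* Up to the kernel [c *: p] is [ex g] and [c *: re p] is [re (ex g) = g]; cancelling [c] shows that
   [p] and [ex (re p)] have the same value under [f]. *)
apply: (Q_cancel c0); rewrite scalerBr -exZ.
have -> : c *: re p = re (c *: p - ex g) + g by rewrite reB reK subrK [RHS]retractZ.
rewrite [ex _]expandD -/(ex g) -/(ex (re (c *: p - ex g))) opprDr_swap.
apply: supp_inB => //.
by apply: Q_expand; apply: Q_retract.
Qed.

Lemma aleph1_free_image : aleph1_free N.
Proof.
apply: aleph1_free_of_separated => //; first exact: image_submod.
move=> a aN n; have [k kP] := closure_at_level n aN.
have /choice [r rP] w : exists p, head_closure a n w -> G p /\ w = f (evx k p).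
  have [/kP [p Gp wp]|nw] := pselect (head_closure a n w); first by exists p.
  by exists 0 => /nw.
move=> w hw w0; have [Gw wE] := rP w hw.
have [mm nQ mmw] : exists2 mm, ~ Q mm & (r w)@_mm != 0.
  apply: contrapT => h; case/eqP: w0; rewrite wE; apply/f_ker => //.
  apply/supp_inE => mm nQ; apply/eqP; apply: contrapT => /negP mm0.
  by apply: h; exists mm.
(* The functional is a coefficient of the chosen representative of level [k]. Two representatives of
   one element differ by a polynomial supported in [Q], hence agree at [mm]. *)
exists (fun v => (r v)@_mm) => // c u v hu hv.
have [[Gu uE] [Gv vE]] := (rP u hu, rP v hv).
have hcuv : head_closure a n (c *: u + v).
  have sH := head_closure_submod a n.
  by apply: (submodD sH) => //; apply: (submodZ _ sH).
have [Gs sE] := rP _ hcuv.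
have Gd : G (r (c *: u + v) - (c *: r u + r v)) by apply: supp_inB; last apply: linG.
have /(f_ker k Gd)/supp_inE/(_ mm nQ) : f (evx k (r (c *: u + v) - (c *: r u + r v))) = 0.
  by rewrite f_evB f_ev_lin -sE -uE -vE subrr.
by rewrite mcoeffB mcoeffD mcoeffZ => /eqP; rewrite subr_eq0 => /eqP.
Qed.

End FreeQuotients.

(** * Injections and comparison of cardinals *)

Definition inj_on (T U : Type) (A : set T) (f : T -> U) :=
  forall x y, A x -> A y -> f x = f y -> x = y.

Lemma card_le_inj (T U : Type) (A : set T) (B : set U) (u0 : U) : A #<= B ->
  exists2 f : T -> U, inj_on A f & forall x, A x -> B (f x).
Proof.
move=> /card_leP [f].
exists (fun x => if pselect (A x) is left Ax then val (f (exist _ x (mem_set Ax))) else u0).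
  move=> x y Ax Ay; case: pselect => // Ax'; case: pselect => // Ay' /val_inj.
  by move=> /(@inj _ _ _ f) h; have := h (mem_set I) (mem_set I) => /(congr1 val).
move=> x Ax; case: pselect => // Ax'; case: (f _) => y By /=; exact: set_mem.
Qed.

Lemma inj_card_le (T U : choiceType) (A : set T) (f : T -> U) : inj_on A f ->
  A #<= [set: U].
Proof.
move=> finj; have /card_eqPle [/card_le_trans h _] : A #= f @` A.
  rewrite card_eq_sym; apply: inj_card_eq => x y; rewrite !inE; exact: finj.
by apply: h; apply: subset_card_le.
Qed.

(** * Cardinality *)

Section SmallSets.
Variables (L : Type) (phi : L -> L -> L) (emb_nat : nat -> L).
Hypothesis phi_inj : forall a c a' c', phi a c = phi a' c' -> a = a' /\ c = c'.
Hypothesis emb_nat_inj : injective emb_nat.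

(** Cardinality at most that of [L]; the pairing [phi] keeps products and finite sequences within
    this bound. *)
Definition small (T : Type) (A : set T) := exists f : T -> L, inj_on A f.

Lemma small_countable (T : Type) (A : set T) : countable A -> small A.
Proof.
move=> /(card_le_inj 0%N) [f finj _]; exists (emb_nat \o f) => x y Ax Ay /emb_nat_inj.
exact: finj.
Qed.

Lemma smallX (T U : Type) (A : set T) (B : set U) : small A -> small B -> small (A `*` B).
Proof.
move=> [f finj] [g ginj]; exists (fun p => phi (f p.1) (g p.2)).
move=> [x y] [x' y'] [/= Ax By] [/= Ax' By'] /phi_inj [fx gy].
by rewrite (finj x x') // (ginj y y').
Qed.

Lemma small_seq (T : eqType) (A : set T) : small A ->
  small [set r : seq T | forall x, x \in r -> A x].
Proof.
move=> [f finj].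
pose enc := fix enc (r : seq T) := if r is x :: r' then phi (f x) (enc r') else emb_nat 0%N.
(* The length is recorded because the code of the empty sequence may also be a value of [phi]. *)
exists (fun r => phi (emb_nat (size r)) (enc r)) => r r' /= rA rA' /phi_inj [/emb_nat_inj].
elim: r r' rA rA' => [|x r IH] [|x' r'] //= rA rA' [rr'] /phi_inj [fx er].
congr (_ :: _); first by apply: finj => //; [apply: rA|apply: rA']; apply: mem_head.
apply: IH => // y yr; [apply: rA|apply: rA']; by rewrite inE yr orbT.
Qed.

Lemma small_inj (T U : Type) (A : set T) (B : set U) (g : T -> U) :
  inj_on A g -> (forall x, A x -> B (g x)) -> small B -> small A.
Proof.
move=> ginj AB [f finj]; exists (f \o g) => x y Ax Ay /finj h.
by apply: ginj => //; apply: h; apply: AB.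
Qed.

(** A polynomial is coded by the finite list of its coefficients and exponents, from which each
    nonzero coefficient can be read off. *)
Lemma small_malg (K : choiceType) (F : comNzRingType) (G : K -> Prop) :
  countable [set: F] -> small [set k | G k] ->
  small [set p : {malg F[{cmonom K}]} | poly_in G p].
Proof.
move=> Fc Gs.
pose mcode (m : {cmonom K}) := [seq (k, m k) | k <- enum_fset (finsupp m)].
pose code (p : {malg F[{cmonom K}]}) := [seq (p@_m, mcode m) | m <- enum_fset (msupp p)].
have mcodeP m k e : (k, e) \in mcode m -> e = m k /\ k \in finsupp m.
  by case/mapP => j jm [-> ->].
have mcode_le m m' k : mcode m = mcode m' -> m k != 0%N -> m' k = m k.
  rewrite cmE_neq0 => mm' km; have : (k, m k) \in mcode m by apply: map_f.
  by rewrite mm' => /mcodeP [].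
have mcode_inj m m' : mcode m = mcode m' -> m = m'.
  move=> mm'; apply/eqP/cmP => k.
  have [m0|/(mcode_le _ _ _ mm') //] := eqVneq (m k) 0%N.
  by have [m'0|/(mcode_le _ _ _ (esym mm'))] := eqVneq (m' k) 0%N; [rewrite m0 m'0|].
have code_le p p' m : code p = code p' -> p@_m != 0 -> p'@_m = p@_m.
  rewrite mcoeff_neq0 => pp' mp; have : (p@_m, mcode m) \in code p.
    exact: (map_f (fun m => (p@_m, mcode m))).
  by rewrite pp' => /mapP [m' _ [-> /mcode_inj ->]].
have code_inj p p' : code p = code p' -> p = p'.
  move=> pp'; apply/malgP => m.
  have [p0|/(code_le _ _ _ pp') //] := eqVneq p@_m 0.
  by have [p'0|/(code_le _ _ _ (esym pp'))] := eqVneq p'@_m 0; [rewrite p0 p'0|].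
pose A1 := [set r : seq (K * nat) | forall z, z \in r -> ([set k | G k] `*` [set: nat]) z].
pose A2 := [set r : seq (F * seq (K * nat)) | forall y, y \in r -> ([set: F] `*` A1) y].
apply: (@small_inj _ _ _ A2 code) => [p p' _ _|p pG _ /mapP [m mp ->]|]; first exact: code_inj.
  split=> //= _ /mapP [k km ->] /=; split=> //; apply: (pG m mp).
  by rewrite cmE_neq0.
apply: small_seq; apply: smallX; first exact: small_countable.
apply: small_seq; apply: smallX; first exact: Gs.
exact: (small_countable (countableP _)).
Qed.

End SmallSets.

Section Cardinality.
Variables (F : idomainType) (s : nat -> F).
Hypothesis F_countable : countable [set: F].
Variables (d : Order.disp_t) (L : orderType d).
Hypothesis L_infinite : infinite_set [set: L].
Variables (C : L -> set nat) (V : forall a : L, set (branch (C a))).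
Hypothesis V_card : forall a, @V a #= [set: L].
Variable b : L -> base_alg F C.
Hypothesis b_often : forall e, monomial_sum e -> [set a | b a = e] #= [set: L].

Lemma nil_in_tree (a : L) : [::] \in tree (C a).
Proof. by rewrite inE. Qed.

Definition tree_root (a : L) : var C :=
  Tagged (fun a => tree (C a)) (exist _ [::] (nil_in_tree a)).

Lemma zvar_inj : injective (@zvar F _ L C).
Proof. by move=> t t'; apply: malgX_inj. Qed.

Lemma zvar_monomial_sum t : monomial_sum (zvar F t : base_alg F C).
Proof.
split; first by rewrite monalgU_eq0 oner_eq0.
by exists [fset ucm t]%fset; rewrite big_seq_fset1.
Qed.

(* The fibres of [b] over the roots are pairwise disjoint copies of L. *)
Lemma pairing_exists : exists phi : L -> L -> L,
  forall a c a' c', phi a c = phi a' c' -> a = a' /\ c = c'.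
Proof.
have [a0 _] := infinite_setN0 L_infinite.
have /choice [phi phiP] a : exists f : L -> L,
    injective f /\ forall c, b (f c) = zvar F (tree_root a).
  have /card_eqPle [_ /(card_le_inj a0) [f finj fb]] :=
    b_often (zvar_monomial_sum (tree_root a)).
  by exists f; split=> [c c' /finj|c]; [apply|apply: (fb c)].
exists phi => a c a' c' e; have [pinj pb] := phiP a; have [_ pb'] := phiP a'.
have /zvar_inj/(congr1 tag) /= aa' : zvar F (tree_root a) = zvar F (tree_root a').
  by rewrite -(pb c) e pb'.
by split=> //; apply: pinj; rewrite e aa'.
Qed.

Lemma nat_embedding : exists emb_nat : nat -> L, injective emb_nat.
Proof.
have [a0 _] := infinite_setN0 L_infinite.
have /(card_le_inj a0) [f finj _] := proj1 (infiniteP _) L_infinite.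
by exists f => n m; apply: finj.
Qed.

(** The elements are values of pairs of a level and a polynomial. The tags come from [L], finite
    branches are countably many, and each [V a] is as large as [L]. *)
Lemma model_card_le (ds : (nat -> bhat s C) -> nat -> bhat s C) wf T :
  model V ds b wf T #<= [set: L].
Proof.
have [phi phi_inj] := pairing_exists; have [emb_nat emb_nat_inj] := nat_embedding.
have [a0 _] := infinite_setN0 L_infinite.
have smallL : small L [set: L] by exists id.
have smallK : small L [set k | key_in V T k].
  have gE a : exists f : branch (C a) -> L, inj_on (@V a) f.
    by have /card_eqPle [/(card_le_inj a0) [f finj _] _] := V_card a; exists f.
  have [h hinj] := small_countable emb_nat_inj (countableP [set: seq bool]).
  (* The leading 0 or 1 separates the two kinds of variables. *)
  exists (fun k => match k with
    | KZ t => phi (emb_nat 0%N) (phi (tag t) (h (val (tagged t))))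
    | KY e => phi (emb_nat 1%N) (phi (tag e) (sval (cid (gE (tag e))) (tagged e))) end).
  move=> [[a t]|[a e]] [[a' t']|[a' e']] /= => [_ _|||[_ Ve] [_ Ve']].
  - move=> /phi_inj [_ /phi_inj [aa' /hinj tt']]; subst a'.
    by congr (KZ (Tagged _ _)); apply: val_inj; apply: tt'.
  - by move=> _ _ /phi_inj [/emb_nat_inj].
  - by move=> _ _ /phi_inj [/emb_nat_inj].
  move=> /phi_inj [_ /phi_inj [aa' ee']]; subst a'.
  by rewrite (svalP (cid (gE a)) e e').
have [f finj] := smallX phi_inj (small_countable emb_nat_inj (countableP [set: nat]))
  (small_malg phi_inj emb_nat_inj F_countable smallK).
apply: card_le_trans (inj_card_le finj).
apply: card_le_trans (card_image_le (fun np => ev ds (sel V ds b wf) np.1 np.2) _).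
by apply: subset_card_le => u [n [p [pT ->]]]; exists (n, p).
Qed.

End Cardinality.

(** * The domain property, the cardinality and the freeness of [R] and its quotients *)

Arguments pos {d L} c.

Lemma supp_in_False (K : choiceType) (F : comNzRingType) (p : {malg F[{cmonom K}]}) :
  supp_in (fun=> False) p <-> p = 0.
Proof.
split=> [/supp_inE h|->]; last exact: supp_in0.
by apply/malgP => m; rewrite mcoeff0 h.
Qed.

Lemma quot_map_eq0 (F : comNzRingType) (M : lmodType F) (N : set M) u :
  submodule N -> (quot_map N u = 0 <-> N u).
Proof.
move=> sN; have q0 : quot_map N 0 = 0 :> quot_mod N.
  by rewrite -(scale0r (0 : M)) quot_mapZ; apply: (scale0r (quot_map N 0 : quot_mod N)).
by rewrite -q0 quot_mapP subr0 lspan_id.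
Qed.

Theorem theorem3p6
  (F : idomainType) (s : nat -> F)
  (F_pid : principal_ideal_domain F)
  (F_countable : countable [set: F])
  (S_infinite : infinite_set (range s))
  (S_coprime : pairwise_coprime s)
  (S_nonzero : forall n, s n != 0)
  (S_sep : S_hausdorff s)
  (d : Order.disp_t) (L : orderType d)
  (L_wf : well_founded (fun c a : L => (c < a)%O))
  (L_regular : regular_cardinal L)
  (L_uncountable : ~ countable [set: L])
  (L_continuum : [set: L] #<= [set: nat -> bool])
  (C : L -> set nat)
  (C_infinite : forall a, infinite_set (C a))
  (C_ad : almost_disjoint C)
  (V : forall a : L, set (branch (C a)))
  (V_card : forall a, V a #= [set: L])
  (V_pairs : forall a, many_pairs (V a))
  (ds : (nat -> bhat s C) -> nat -> bhat s C)
  (ds_sum : forall u, tail_series u (ds u))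
  (b : L -> base_alg F C)
  (b_sum : forall a, monomial_sum (b a))
  (b_often : forall e, monomial_sum e -> [set a | b a = e] #= [set: L]) :
  let R := Rtop ds V b L_wf in
  let Ra := Ralpha ds V b L_wf in
  [/\ is_domain R, R #= [set: L], aleph1_free R
    & forall a : L, aleph1_free (quot_map (Ra a) @` R)].
Proof.
move=> R Ra; have [L_infinite _ L_reg] := L_regular.
have [l0 _] := infinite_setN0 L_infinite.
have unbounded (a : L) : exists e, (a < e)%O.
  (* A singleton is smaller than the infinite index set, so regularity bounds it strictly. *)
  have [h|e ae] := L_reg [set a]; last by exists e; apply: ae.
  by apply: L_infinite; apply: card_le_finite h (finite_set1 a).
have RE : R = model V ds b L_wf pos.
  by apply: Rtop_model => //; exists l0.
have RaE a : ~ ozero a -> Ra a = model V ds b L_wf (pos_below a) by apply: Ralpha_model.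
have clT : tag_closed V (sel V ds b L_wf) pos by apply: sel_pos_closed.
have ev0_eq n p : ev ds (sel V ds b L_wf) n p = 0 <-> supp_in (fun=> False) p.
  split=> [|/supp_in_False ->]; last exact: ev0.
  by move=> p0; apply/supp_in_False; apply: ev_inj0 p0.
have expand_False c n m p : supp_in (fun=> False) p ->
    supp_in (fun=> False) (expand s (sel V ds b L_wf) c n m p).
  by move=> /supp_in_False ->; apply/supp_in_False; apply: (rmorph0 (malgev _ _)).
have retract_False D c n m k u p : (forall e, KY e \in D -> V (tag e) (tagged e)) ->
    supp_in (fun=> False) p ->
    supp_in (fun=> False) (retract s (sel V ds b L_wf) D c n m k u p).
  by move=> _ /supp_in_False ->; apply/supp_in_False; apply: (rmorph0 (malgev _ _)).
have sR := model_subalgebra ds_sum clT; have [smR MC _ _] := subalgebraP sR.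
split.
- split; rewrite ?RE.
  + split.
    * by have [_ []] := sR.
    * by move=> u v; rewrite !inE; apply: submodB.
    * by have [_ []] := sR.
  + apply/eqP => one0; have := oner_neq0 {malg F[{cmonom (key C)}]}.
    have : ev ds (sel V ds b L_wf) 0 1 = 0 by rewrite ev1.
    by move=> /ev0_eq/supp_in_False ->; rewrite eqxx.
  + move=> u v [n [p [_ ->]]] [m [p' [_ ->]]].
    (* At a common level the product is the value of a product of polynomials; evaluation is
       injective and polynomials have no zero divisors. *)
    have [k [r [r' [-> -> _]]]] := ev_max ds_sum (sel V ds b L_wf) n m p p'.
    rewrite -evM => /ev0_eq/supp_in_False/malg_integral [->|->]; rewrite ev0; by [left|right].
- apply/card_eqPle; split; first by rewrite RE; apply: model_card_le.
  (* The branches in [V a] at one positive index already give as many distinct elements as [L]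
     has. *)
  have [a l0a] := unbounded l0.
  have a0 : ~ ozero a by move=> /(_ l0); rewrite leNgt l0a.
  pose y (eta : branch (C a)) := ev ds (sel V ds b L_wf) 0 (fvar F (KY (existT _ a eta))).
  have /card_eqPle [_ h] := V_card a; apply: card_le_trans h _.
  have yinj : {in V a &, injective y}.
    move=> eta eta' _ _ yy; have : ev ds (sel V ds b L_wf) 0
        (fvar F (KY (existT _ a eta)) - fvar F (KY (existT _ a eta'))) = 0.
      by rewrite evB; apply/eqP; rewrite subr_eq0; apply/eqP; apply: yy.
    move=> /ev0_eq/supp_in_False/eqP; rewrite subr_eq0 => /eqP.
    by move=> /malgX_inj [] /eqP; rewrite eq_Tagged => /eqP.
  have /card_eqPle [_ h'] := inj_card_eq yinj; apply: card_le_trans h' _.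
  apply: subset_card_le => _ [eta Veta <-]; rewrite RE.
  by exists 0%N, (fvar F (KY (existT _ a eta))); split=> //; apply: poly_inX.
- rewrite RE; apply: (@aleph1_free_image _ _ F_pid _ _ _ _ _ ds_sum _ _ clT _ id
    (fun _ _ _ => erefl) (fun=> False) _ expand_False retract_False).
  by move=> n p _; apply: ev0_eq.
move=> a; have sRa : submodule (Ra a) by apply: Ralpha_submod.
have fE : quot_map (Ra a) @` R = [set w | exists n p,
    poly_in (key_in V pos) p /\ w = quot_map (Ra a) (ev ds (sel V ds b L_wf) n p)].
  rewrite RE; apply/seteqP; split=> [_ [_ [n [p [pT ->]]] <-]|w [n [p [pT ->]]]].
    by exists n, p.
  by exists (ev ds (sel V ds b L_wf) n p) => //; exists n, p.
have f_lin (c : F) u v : quot_map (Ra a) (c *: u + v) =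
    c *: quot_map (Ra a) u + quot_map (Ra a) v by rewrite quot_mapD quot_mapZ.
rewrite fE; have [a0|a0] := pselect (ozero a).
  (* Here R_a is 0, so only the zero polynomial is killed. *)
  apply: (@aleph1_free_image _ _ F_pid _ _ _ _ _ ds_sum _ _ clT _ _
    f_lin (fun=> False) _ expand_False retract_False).
  move=> n p _; apply: iff_trans (quot_map_eq0 _ sRa) _.
  by rewrite [Ra a](Ralpha0 _ _ _ _ a0); apply: ev0_eq.
have clTa : tag_closed V (sel V ds b L_wf) (pos_below a) by apply: sel_below_closed.
(* A value lies in R_a exactly when the polynomial has only variables of index below [a], since
   equal values force this on every representative. *)
apply: (@aleph1_free_image _ _ F_pid _ _ _ _ _ ds_sum _ _ clT _ _
    f_lin (mon_in (key_in V (pos_below a)))).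
- move=> n p pT; apply: iff_trans (quot_map_eq0 _ sRa) _; rewrite RaE //.
  split=> [[m [p' [p'T pp']]]|pa].
    exact: (ev_poly_in S_coprime S_nonzero S_sep ds_sum clTa pT p'T pp').
  by exists n, p.
- by move=> c n m p; apply: poly_in_expand.
- by move=> D c n m k u p VD; apply: poly_in_retract.
Qed.
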